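(* Let $\mathcal{F}$ be a topologically closed set of density operators on a finite-dimensional Hilbert space $\mathcal{H}$ (and, on other spaces, a corresponding closed set of free states). The projective robustness $\Omega_{\mathcal F}$ satisfies: (i) For a state $\rho$, $\Omega_{\mathcal F}(\rho)<\infty$ if and only if there exists $\sigma\in\mathcal F$ with $\operatorname{supp}\sigma=\operatorname{supp}\rho$. (ii) $\Omega_{\mathcal F}(\lambda\rho)=\Omega_{\mathcal F}(\rho)$ for every $\lambda>0$. (iii) $\Omega_{\mathcal F}(\rho)=\inf\{\gamma\in\mathbb R:\ \rho\le\tilde\sigma\le\gamma\rho,\ \tilde\sigma\in\mathrm{cone}(\mathcal F)\}$, and this infimum is attained whenever it is finite. If moreover $\mathcal F$ is convex, then $\Omega_{\mathcal F}(\rho)=\sup\{\langle A,\rho\rangle:\ \langle B,\rho\rangle=1,\ B-A\in\mathrm{cone}(\mathcal F)^*,\ A,B\ge0\}=\sup\left\{\frac{\langle A,\rho\rangle}{\langle B,\rho\rangle}:\ \frac{\langle A,\sigma\rangle}{\langle B,\sigma\rangle}\le1\ \forall\sigma\in\mathcal F,\ A,B\ge0\right\}$, where in the last expression the supremum is over $A,B\ge 0$ with $\langle B,\rho\rangle\neq0$ and $\langle B,\sigma\rangle\neq0$ for all $\sigma\in\mathcal F$. (iv) For any state $\rho$, $\Omega_{\mathcal F}(\rho)=1$ if and only if $\rho\in\mathcal F$. (v) If the free sets are closed under tensor product (i.e. $\sigma_1,\sigma_2\in\mathcal F\Rightarrow\sigma_1\otimes\sigma_2\in\mathcal F$), then $\Omega_{\mathcal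 F}(\rho\otimes\omega)\le\Omega_{\mathcal F}(\rho)\,\Omega_{\mathcal F}(\omega)$ for all states $\rho,\omega$. Alternatively, if $\sigma\in\mathcal F\Rightarrow\sigma^{\otimes n}\in\mathcal F$ for all $n\in\mathbb N$, then $\Omega_{\mathcal F}(\rho^{\otimes n})\le\Omega_{\mathcal F}(\rho)^n$. (vi) If $\mathcal F$ is convex, then $\Omega_{\mathcal F}(t\rho+(1-t)\omega)\le\max\{\Omega_{\mathcal F}(\rho),\Omega_{\mathcal F}(\omega)\}$ for all states $\rho,\omega$ and $t\in[0,1]$. (vii) $\Omega_{\mathcal F}$ is lower semicontinuous: $\Omega_{\mathcal F}(\rho)\le\liminf_{n\to\infty}\Omega_{\mathcal F}(\rho_n)$ for every sequence of states $\rho_n\to\rho$. (viii) $R_{\mathcal F}(\rho)\,W_{\mathcal F}(\rho)^{-1}\le\Omega_{\mathcal F}(\rho)\le R_{\mathcal F}(\rho)\,R_{\max}(\sigma^\star_R\|\rho)\le R_{\mathcal F}(\rho)\,\lambda_{\min}(\rho)^{-1}$ and $\Omega_{\mathcal F}(\rho)\le W_{\mathcal F}(\rho)^{-1}R_{\max}(\rho\|\sigma^\star_W)$, where $\lambda_{\min}(\rho)$ is the smallest eigenvalue of $\rho$, $\sigma^\star_R\in\mathcal F$ is a state with $R_{\mathcal F}(\rho)=R_{\max}(\rho\|\sigma^\star_R)$ and $\sigma^\star_W\in\mathcal F$ is a state with $W_{\mathcal F}(\rho)=R_{\max}(\sigma^\star_W\|\rho)^{-1}$, whenever such states exist.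
   Context: All Hilbert spaces are finite-dimensional; operators are self-adjoint with inner product $\langle A,B\rangle=\mathrm{Tr}(AB)$. $A\le B$ means $B-A$ is positive semidefinite. $\mathrm{cone}(\mathcal F)=\{\lambda\sigma:\lambda\ge0,\sigma\in\mathcal F\}$ and $\mathrm{cone}(\mathcal F)^*=\{X \text{ self-adjoint}:\langle X,\sigma\rangle\ge0\ \forall\sigma\in\mathcal F\}$. Conventions: $\inf\emptyset=\infty$, $0^{-1}=\infty$, $\infty^{-1}=0$, $c\cdot\infty=\infty$ for $c>0$. For positive semidefinite $X,Y$: $R_{\max}(X\|Y)=\inf\{\lambda: X\le\lambda Y\}$. Robustness $R_{\mathcal F}(\rho)=\min_{\sigma\in\mathcal F}R_{\max}(\rho\|\sigma)$; resource weight $W_{\mathcal F}(\rho)=\sup\{\nu:\rho\ge\nu\sigma,\ \sigma\in\mathcal F\}=[\min_{\sigma\in\mathcal F}R_{\max}(\sigma\|\rho)]^{-1}$. The projective robustness of a (possibly unnormalised) positive semidefinite operator $\rho$ is $\Omega_{\mathcal F}(\rho)=\inf_{\sigma\in\mathcal F}R_{\max}(\rho\|\sigma)R_{\max}(\sigma\|\rho)=\inf\{\lambda/\nu:\ \nu\sigma\le\rho\le\lambda\sigma,\ \sigma\in\mathcal F\}$. *)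

(* Defs.v *)
From HB Require Import structures.
From mathcomp Require Import all_boot all_order all_algebra.
From mathcomp Require Import complex mxtens.
From mathcomp Require Import boolp classical_sets reals constructive_ereal ereal
  topology normedtype sequences.
Set Implicit Arguments. Unset Strict Implicit. Unset Printing Implicit Defensive.
Import Order.TTheory GRing.Theory Num.Theory numFieldNormedType.Exports.
Local Open Scope ring_scope.
Local Open Scope classical_set_scope.

Section QDefs.
Variable R : realType.
Local Notation C := (R[i]).

Definition adjmx m p (A : 'M[C]_(m, p)) : 'M[C]_(p, m) := map_mx Num.conj A^T.

Definition selfadj n (A : 'M[C]_n) : Prop := adjmx A = A.

Definition psd n (A : 'M[C]_n) : Prop :=
  selfadj A /\ forall v : 'cV[C]_n, 0 <= (adjmx v *m A *m v) 0 0.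

Definition mxle n (A B : 'M[C]_n) : Prop := psd (B - A).

Definition density n (A : 'M[C]_n) : Prop := psd A /\ \tr A = 1.

(* Hilbert-Schmidt inner product <A,B> = Tr(AB) (real part; it is real for
   self-adjoint A, B) *)
Definition ip n (A B : 'M[C]_n) : R := complex.Re (\tr (A *m B)).

Definition rscale n (l : R) (A : 'M[C]_n) : 'M[C]_n := (l%:C)%C *: A.

Definition Rmax n (X Y : 'M[C]_n) : \bar R :=
  ereal_inf [set (l%:E) | l in [set l : R | (0 <= l)%R /\ mxle X (rscale l Y)]].

Definition Omega n (F : set 'M[C]_n) (rho : 'M[C]_n) : \bar R :=
  ereal_inf [set (Rmax rho s * Rmax s rho)%E | s in F].

Definition robustness n (F : set 'M[C]_n) (rho : 'M[C]_n) : \bar R :=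
  ereal_inf [set Rmax rho s | s in F].
Definition weight n (F : set 'M[C]_n) (rho : 'M[C]_n) : \bar R :=
  ((ereal_inf [set Rmax s rho | s in F])^-1)%E.

Definition cone n (F : set 'M[C]_n) : set 'M[C]_n :=
  [set X | exists l s, (0 <= l)%R /\ F s /\ X = rscale l s].
Definition dualcone n (F : set 'M[C]_n) : set 'M[C]_n :=
  [set X | selfadj X /\ forall s, F s -> (0 <= ip X s)%R].

(* support equality: equal ranges (column spaces) *)
Definition same_support n (A B : 'M[C]_n) : bool := (A^T == B^T)%MS.

(* entrywise convergence of a sequence of operators (the standard topology
   of the finite-dimensional space 'M[C]_n) *)
Definition mx_cvg n (u : nat -> 'M[C]_n) (a : 'M[C]_n) : Prop :=
  forall i j, ((fun k => complex.Re (u k i j)) @ \oo --> complex.Re (a i j))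
           /\ ((fun k => complex.Im (u k i j)) @ \oo --> complex.Im (a i j)).

(* topologically closed (= sequentially closed in finite dimension) *)
Definition mx_closed n (F : set 'M[C]_n) : Prop :=
  forall (u : nat -> 'M[C]_n) a, (forall k, F (u k)) -> mx_cvg u a -> F a.

Definition mx_convex n (F : set 'M[C]_n) : Prop :=
  forall s t (l : R), F s -> F t -> (0 <= l <= 1)%R ->
    F (rscale l s + rscale (1 - l) t).

Definition free_set n (F : set 'M[C]_n) : Prop :=
  F `<=` (@density n) /\ mx_closed F.

Definition lambda_min n (A : 'M[C]_n) : \bar R :=
  ereal_inf [set (l%:E) | l in [set l : R | eigenvalue A (l%:C)%C%C]].

End QDefs.

(* Main.v *)
(** Write [rho <= st <= g rho] with [st] in the cone over [F]: [Omega F rho] is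
    the least such [g]. Traces bound [st], so compactness of the free states
    gives attainment, faithfulness and lower semicontinuity; adding or tensoring
    feasible [st] gives quasi-convexity and submultiplicativity. For duality, if
    [g] is infeasible, the pairs [(rho + P - st, st + Q - g rho)] with [P], [Q]
    positive and [st] in the cone avoid [0]; they have a shortest element
    [(A, B)], again by a trace bound, and its optimality says that [(A, B)] is a
    dual point with [<A, rho> > g <B, rho>]. Finiteness rests on the fact that
    range inclusion of positive operators is the same as domination up to a
    factor. *)

Require Import Defs.
From HB Require Import structures.
From mathcomp Require Import all_boot all_order all_algebra.
From mathcomp Require Import spectral ring lra.
From mathcomp Require Import complex mxtens.
From mathcomp Require Import boolp classical_sets reals constructive_ereal ereal
  topology normedtype sequences.
Set Implicit Arguments. Unset Strict Implicit. Unset Printing Implicit Defensive.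
Import Order.TTheory GRing.Theory Num.Theory numFieldNormedType.Exports.
Local Open Scope ring_scope.
Local Open Scope classical_set_scope.

(** Two obstacles shape the argument. Products of extended reals are deceptive, since [0 * +oo = 0]:
    a finite product bounds both [Rmax] factors only because nonzero positive operators keep each
    factor positive. Hence [rho != 0] in the passage to the conic form, where the free scale of [st]
    merges the two factors into the single [g]. For duality, a sum of closed cones need not be
    closed, so separation needs compactness from elsewhere. The slack pair is arranged for this: a
    bound on its second entry bounds [tr st + tr Q], two nonnegative terms, and its first entry then
    bounds [tr P]. The dual point found in this way may satisfy [<B, rho> = 0] and cannot then be
    normalised; it is a direction of unboundedness and yields admissible pairs of arbitrarily large
    value. *)

Section ComplexParts.
Variable R : realType.
Local Notation C := R[i].
Implicit Types (z w : C) (l : R).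

Lemma ReD z w : complex.Re (z + w) = complex.Re z + complex.Re w.
Proof. by case: z w => [a b] [c d]. Qed.
Lemma ImD z w : complex.Im (z + w) = complex.Im z + complex.Im w.
Proof. by case: z w => [a b] [c d]. Qed.
Lemma ReN z : complex.Re (- z) = - complex.Re z.
Proof. by case: z. Qed.
Lemma ReME z w : complex.Re (z * w) =
  complex.Re z * complex.Re w - complex.Im z * complex.Im w.
Proof. by case: z w => [a b] [c d]. Qed.
Lemma ImME z w : complex.Im (z * w) =
  complex.Re z * complex.Im w + complex.Im z * complex.Re w.
Proof. by case: z w => [a b] [c d]. Qed.
Lemma ReZ l z : complex.Re (l%:C%C * z) = l * complex.Re z.
Proof. by rewrite ReME /= mul0r subr0. Qed.
Lemma Re_conjE z : complex.Re (Num.conj z) = complex.Re z.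
Proof. by case: z. Qed.
Lemma Im_conjE z : complex.Im (Num.conj z) = - complex.Im z.
Proof. by case: z. Qed.
Lemma conj_realC l : Num.conj (l%:C%C : C) = l%:C%C.
Proof. by rewrite /= /Num.conj /= oppr0. Qed.
Lemma Re_sum I (r : seq I) (P : pred I) (f : I -> C) :
  complex.Re (\sum_(i <- r | P i) f i) = \sum_(i <- r | P i) complex.Re (f i).
Proof. by apply: (big_morph (@complex.Re R) ReD). Qed.
Lemma ge0_ReIm z : (0 <= z) = (complex.Im z == 0) && (0 <= complex.Re z).
Proof. by rewrite lecE. Qed.
Lemma complexP z w : complex.Re z = complex.Re w -> complex.Im z = complex.Im w ->
  z = w.
Proof. by case: z w => [a b] [c d] /= -> ->. Qed.

End ComplexParts.

(** * Self-adjoint and positive operators *)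

Section Operators.
Variable R : realType.
Local Notation C := R[i].
Local Notation trR A := (complex.Re (\tr A)).

Lemma adjmxM m n p (A : 'M[C]_(m, n)) (B : 'M[C]_(n, p)) :
  adjmx (A *m B) = adjmx B *m adjmx A.
Proof. by rewrite /adjmx trmx_mul map_mxM. Qed.

Lemma adjmxE m n (A : 'M[C]_(m, n)) i j : adjmx A i j = Num.conj (A j i).
Proof. by rewrite !mxE. Qed.

Lemma adjmxK m n (A : 'M[C]_(m, n)) : adjmx (adjmx A) = A.
Proof. by apply/matrixP => i j; rewrite !mxE conjCK. Qed.

Lemma adjmxD m n (A B : 'M[C]_(m, n)) : adjmx (A + B) = adjmx A + adjmx B.
Proof. by apply/matrixP => i j; rewrite !mxE rmorphD. Qed.

Lemma adjmxN m n (A : 'M[C]_(m, n)) : adjmx (- A) = - adjmx A.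
Proof. by apply/matrixP => i j; rewrite !mxE rmorphN. Qed.

Lemma adjmx_rscale n l (A : 'M[C]_n) : adjmx (rscale l A) = rscale l (adjmx A).
Proof. by apply/matrixP => i j; rewrite !mxE rmorphM /= conj_realC. Qed.

Lemma adjmx_scalar n (l : R) : adjmx (l%:C%C%:M : 'M[C]_n) = l%:C%C%:M.
Proof.
apply/matrixP => i j; rewrite !mxE eq_sym.
by case: (i == j); rewrite ?mulr1n ?mulr0n ?conj_realC ?rmorph0.
Qed.

Lemma adjmx1 n : adjmx (1%:M : 'M[C]_n) = 1%:M.
Proof. exact: (adjmx_scalar n 1). Qed.

Lemma rscaleE n l (A : 'M[C]_n) : rscale l A = l%:C%C *: A.
Proof. by []. Qed.

Lemma rscaleA n l m (A : 'M[C]_n) : rscale l (rscale m A) = rscale (l * m) A.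
Proof. by rewrite !rscaleE scalerA -rmorphM. Qed.
Lemma rscale1 n (A : 'M[C]_n) : rscale 1 A = A.
Proof. by rewrite rscaleE scale1r. Qed.
Lemma rscale0 n (A : 'M[C]_n) : rscale 0 A = 0.
Proof. by rewrite rscaleE scale0r. Qed.
Lemma rscaleK n l (A : 'M[C]_n) : 0 < l -> rscale l^-1 (rscale l A) = A.
Proof. by move=> l0; rewrite rscaleA mulVf ?gt_eqF // rscale1. Qed.
Lemma rscaleVK n l (A : 'M[C]_n) : 0 < l -> rscale l (rscale l^-1 A) = A.
Proof. by move=> l0; rewrite rscaleA divff ?gt_eqF // rscale1. Qed.
Lemma rscaleDl n l m (A : 'M[C]_n) : rscale (l + m) A = rscale l A + rscale m A.
Proof. by rewrite !rscaleE -scalerDl -rmorphD. Qed.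
Lemma rscaleDr n l (A B : 'M[C]_n) : rscale l (A + B) = rscale l A + rscale l B.
Proof. by rewrite !rscaleE scalerDr. Qed.
Lemma rscalerN n l (A : 'M[C]_n) : rscale l (- A) = - rscale l A.
Proof. by rewrite !rscaleE scalerN. Qed.
Lemma rscaleNr n l (A : 'M[C]_n) : rscale (- l) A = - rscale l A.
Proof. by rewrite !rscaleE rmorphN scaleNr. Qed.

Lemma trRD n (A B : 'M[C]_n) : trR (A + B) = trR A + trR B.
Proof. by rewrite mxtraceD ReD. Qed.
Lemma trRN n (A : 'M[C]_n) : trR (- A) = - trR A.
Proof. by rewrite raddfN ReN. Qed.
Lemma trRB n (A B : 'M[C]_n) : trR (A - B) = trR A - trR B.
Proof. by rewrite trRD trRN. Qed.
Lemma trRZ n l (A : 'M[C]_n) : trR (rscale l A) = l * trR A.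
Proof. by rewrite mxtraceZ ReZ. Qed.

Lemma ipC n (A B : 'M[C]_n) : ip A B = ip B A.
Proof. by rewrite /ip mxtrace_mulC. Qed.
Lemma ipDl n (A B D : 'M[C]_n) : ip (A + B) D = ip A D + ip B D.
Proof. by rewrite /ip mulmxDl trRD. Qed.
Lemma ipDr n (A B D : 'M[C]_n) : ip A (B + D) = ip A B + ip A D.
Proof. by rewrite /ip mulmxDr trRD. Qed.
Lemma ipNl n (A B : 'M[C]_n) : ip (- A) B = - ip A B.
Proof. by rewrite /ip mulNmx trRN. Qed.
Lemma ipNr n (A B : 'M[C]_n) : ip A (- B) = - ip A B.
Proof. by rewrite /ip mulmxN trRN. Qed.
Lemma ipZl n l (A B : 'M[C]_n) : ip (rscale l A) B = l * ip A B.
Proof. by rewrite /ip -scalemxAl trRZ. Qed.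
Lemma ipZr n l (A B : 'M[C]_n) : ip A (rscale l B) = l * ip A B.
Proof. by rewrite /ip -scalemxAr trRZ. Qed.
Lemma ip1l n (A : 'M[C]_n) : ip 1%:M A = trR A.
Proof. by rewrite /ip mul1mx. Qed.
Lemma ip0l n (A : 'M[C]_n) : ip 0 A = 0.
Proof. by rewrite /ip mul0mx mxtrace0. Qed.
Lemma ip0r n (A : 'M[C]_n) : ip A 0 = 0.
Proof. by rewrite ipC ip0l. Qed.

Lemma selfadjD n (A B : 'M[C]_n) : selfadj A -> selfadj B -> selfadj (A + B).
Proof. by rewrite /selfadj adjmxD => -> ->. Qed.
Lemma selfadjN n (A : 'M[C]_n) : selfadj A -> selfadj (- A).
Proof. by rewrite /selfadj adjmxN => ->. Qed.
Lemma selfadjB n (A B : 'M[C]_n) : selfadj A -> selfadj B -> selfadj (A - B).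
Proof. by move=> a /selfadjN; apply: selfadjD. Qed.
Lemma selfadjZ n l (A : 'M[C]_n) : selfadj A -> selfadj (rscale l A).
Proof. by rewrite /selfadj adjmx_rscale => ->. Qed.
Lemma selfadj1 n : selfadj (1%:M : 'M[C]_n).
Proof. exact: adjmx1. Qed.

Lemma qformD n (A B : 'M[C]_n) (v : 'cV[C]_n) :
  (adjmx v *m (A + B) *m v) 0 0 = (adjmx v *m A *m v) 0 0 + (adjmx v *m B *m v) 0 0.
Proof. by rewrite mulmxDr mulmxDl mxE. Qed.

Lemma qformZ n l (A : 'M[C]_n) (v : 'cV[C]_n) :
  (adjmx v *m rscale l A *m v) 0 0 = l%:C%C * (adjmx v *m A *m v) 0 0.
Proof. by rewrite /rscale -scalemxAr -scalemxAl mxE. Qed.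

Lemma qform_ip n (A : 'M[C]_n) (v : 'cV[C]_n) :
  complex.Re ((adjmx v *m A *m v) 0 0) = ip A (v *m adjmx v).
Proof.
rewrite /ip mulmxA mxtrace_mulC mulmxA.
by rewrite /mxtrace big_ord1.
Qed.

Lemma psd_selfadj n (A : 'M[C]_n) : psd A -> selfadj A.
Proof. by case. Qed.

(** Self-adjointness makes each value of the form its own conjugate, so only the sign of the real
    part is at stake. *)
Lemma psdP n (A : 'M[C]_n) : selfadj A ->
  (forall v : 'cV[C]_n, 0 <= complex.Re ((adjmx v *m A *m v) 0 0)) -> psd A.
Proof.
move=> sA h; split=> // v; rewrite ge0_ReIm h andbT.
set z := _ 0 0; have : Num.conj z = z.
  by rewrite -[LHS]adjmxE !adjmxM adjmxK sA mulmxA.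
move=> /(congr1 (@complex.Im R)); rewrite Im_conjE => e.
by apply/eqP; move: e; lra.
Qed.

Lemma psd0 n : psd (0 : 'M[C]_n).
Proof.
split; first by rewrite /selfadj /adjmx trmx0 (map_mx0 Num.conj).
by move=> v; rewrite mulmx0 mul0mx mxE.
Qed.

Lemma psdD n (A B : 'M[C]_n) : psd A -> psd B -> psd (A + B).
Proof.
move=> [sA pA] [sB pB]; split; first exact: selfadjD.
by move=> v; rewrite qformD addr_ge0.
Qed.

Lemma psdZ n l (A : 'M[C]_n) : 0 <= l -> psd A -> psd (rscale l A).
Proof.
move=> l0 [sA pA]; split; first exact: selfadjZ.
by move=> v; rewrite qformZ mulr_ge0 // ler0c.
Qed.

Lemma psd_congr m n (A : 'M[C]_n) (X : 'M[C]_(n, m)) :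
  psd A -> psd (adjmx X *m A *m X).
Proof.
move=> [sA pA]; split; first by rewrite /selfadj !adjmxM adjmxK sA mulmxA.
by move=> v; have := pA (X *m v); rewrite adjmxM !mulmxA.
Qed.

Lemma psd_diag n (d : 'I_n -> R) : (forall i, 0 <= d i) ->
  psd (diag_mx (\row_i (d i)%:C%C)).
Proof.
move=> d0; split.
  apply/matrixP => i j; rewrite !mxE eq_sym.
  by case: eqP => [->|_]; rewrite ?mulr1n ?mulr0n ?conj_realC ?rmorph0.
move=> v; rewrite -mulmxA mul_diag_mx mxE; apply: sumr_ge0 => i _.
rewrite !mxE mulrCA mulr_ge0 ?ler0c //.
by rewrite mulrC mul_conjC_ge0.
Qed.

Lemma psd1 n : psd (1%:M : 'M[C]_n).
Proof.
have := @psd_diag n (fun=> 1) (fun=> ler01).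
suff -> : diag_mx (\row_(_ < n) (1%:C)%C) = 1%:M :> 'M[C]_n by [].
by apply/matrixP => i j; rewrite !mxE.
Qed.

Lemma psd_gram m n (X : 'M[C]_(m, n)) : psd (adjmx X *m X).
Proof. by have := psd_congr X (psd1 m); rewrite mulmx1. Qed.

Lemma psd_diag_ge0 n (A : 'M[C]_n) i : psd A -> 0 <= A i i.
Proof.
move=> [_ /(_ (delta_mx i 0))]; rewrite -mulmxA -colE.
suff -> : adjmx (delta_mx i 0) = delta_mx 0 i :> 'rV[C]_n by rewrite -rowE !mxE.
by rewrite /adjmx trmx_delta map_delta_mx.
Qed.

Lemma psd_tr_ge0 n (A : 'M[C]_n) : psd A -> 0 <= trR A.
Proof.
move=> pA; rewrite /mxtrace Re_sum; apply: sumr_ge0 => i _.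
by move: (psd_diag_ge0 i pA); rewrite ge0_ReIm => /andP[].
Qed.

(** In a unitary eigenbasis the eigenvalues are diagonal entries of a congruence of [A]; these are
    nonnegative, hence real, so a real function [d] records them. *)
Lemma psd_spectral n (A : 'M[C]_n) : psd A ->
  exists (P : 'M[C]_n) (d : 'I_n -> R),
  [/\ adjmx P *m P = 1%:M, P *m adjmx P = 1%:M, (forall i, 0 <= d i) &
      A = adjmx P *m diag_mx (\row_i (d i)%:C%C) *m P].
Proof.
move=> pA; have [sA _] := pA.
have An : A \is normalmx by apply/normalmxP; rewrite -[map_mx _ A^T]/(adjmx A) sA.
pose P := spectralmx A; pose D := spectral_diag A.
have Pu : P \is unitarymx by apply: spectral_unitarymx.
have P1 : P *m adjmx P = 1%:M.
  exact/unitarymxP.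
have P2 : adjmx P *m P = 1%:M by apply: mulmx1C.
have eA : A = adjmx P *m diag_mx D *m P.
  by have := An => /orthomx_spectralP; rewrite invmx_unitary.
have eD : diag_mx D = P *m A *m adjmx P.
  by rewrite eA !mulmxA P1 mul1mx -mulmxA P1 mulmx1.
have D0 i : 0 <= D 0 i.
  have := psd_diag_ge0 i (psd_congr (adjmx P) pA); rewrite adjmxK -eD.
  by rewrite mxE eqxx mulr1n.
exists P, (fun i => complex.Re (D 0 i)); split => //.
  by move=> i; move: (D0 i); rewrite ge0_ReIm => /andP[].
rewrite {1}eA; congr (_ *m diag_mx _ *m _); apply/rowP => i; rewrite mxE.
by apply: complexP => //=; move: (D0 i); rewrite ge0_ReIm => /andP[/eqP].
Qed.

Lemma psd_gramP n (A : 'M[C]_n) : psd A -> exists X : 'M[C]_n, A = adjmx X *m X.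
Proof.
move=> /psd_spectral[P [d [_ _ d0 ->]]].
exists (diag_mx (\row_i (Num.sqrt (d i))%:C%C) *m P).
rewrite adjmxM !mulmxA; congr (_ *m _); rewrite -mulmxA; congr (_ *m _).
rewrite (psd_selfadj (psd_diag (fun i => sqrtr_ge0 (d i)))) mulmx_diag.
congr diag_mx; apply/rowP => i; rewrite !mxE.
by rewrite -rmorphM -expr2 sqr_sqrtr.
Qed.

(** Each eigenvalue is at most the sum of all of them. This turns trace bounds into operator bounds,
    on which the compactness arguments rest. *)
Lemma mxle_tr1 n (A : 'M[C]_n) : psd A -> mxle A (rscale (trR A) 1%:M).
Proof.
move=> /psd_spectral[P [d [P1 P2 d0 eA]]].
have tA : trR A = \sum_i d i.
  rewrite eA mxtrace_mulC mulmxA P2 mul1mx mxtrace_diag Re_sum.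
  by apply: eq_bigr => i _; rewrite mxE.
have dle i : 0 <= trR A - d i.
  rewrite tA (bigD1 i) //= addrAC subrr add0r; exact: sumr_ge0.
have := psd_congr P (psd_diag dle); rewrite /mxle.
suff -> : adjmx P *m diag_mx (\row_i (trR A - d i)%:C%C) *m P =
  rscale (trR A) 1%:M - A by [].
have -> : diag_mx (\row_i (trR A - d i)%:C%C) =
    rscale (trR A) 1%:M - diag_mx (\row_i (d i)%:C%C).
  by apply/matrixP => i j; rewrite !mxE rmorphB mulrnBl mulr_natr.
rewrite mulmxBr mulmxBl -eA /rscale -scalemxAr -scalemxAl mulmx1.
by rewrite P1.
Qed.

Lemma ip_ge0 n (A B : 'M[C]_n) : psd A -> psd B -> 0 <= ip A B.
Proof.
move=> /psd_gramP[X ->] pB; rewrite /ip -mulmxA mxtrace_mulC.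
by have := psd_tr_ge0 (psd_congr (adjmx X) pB); rewrite adjmxK.
Qed.

Lemma mxle_tr n (A B : 'M[C]_n) : mxle A B -> trR A <= trR B.
Proof. by move/psd_tr_ge0; rewrite trRB subr_ge0. Qed.

Lemma ip_mono n (A X Y : 'M[C]_n) : psd A -> mxle X Y -> ip A X <= ip A Y.
Proof. by move=> pA /(ip_ge0 pA); rewrite ipDr ipNr subr_ge0. Qed.

(** On self-adjoint operators [ip] is Euclidean in the real coordinates, whence definiteness and
    control of the entries. *)
Lemma ip_sumsq n (A : 'M[C]_n) : selfadj A ->
  ip A A = \sum_i \sum_j (complex.Re (A i j) ^+ 2 + complex.Im (A i j) ^+ 2).
Proof.
move=> sA; rewrite /ip /mxtrace Re_sum; apply: eq_bigr => i _.
rewrite mxE Re_sum; apply: eq_bigr => j _.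
rewrite -{2}sA !mxE ReME Re_conjE Im_conjE; ring.
Qed.

Lemma ip_self_ge0 n (A : 'M[C]_n) : selfadj A -> 0 <= ip A A.
Proof.
move=> sA; rewrite ip_sumsq //; apply: sumr_ge0 => i _; apply: sumr_ge0 => j _.
by rewrite addr_ge0 ?sqr_ge0.
Qed.

Lemma entry_le_ip n (A : 'M[C]_n) i j : selfadj A ->
  complex.Re (A i j) ^+ 2 + complex.Im (A i j) ^+ 2 <= ip A A.
Proof.
move=> sA; rewrite ip_sumsq // (bigD1 i) //= (bigD1 j) //= -addrA lerDl.
apply: addr_ge0; apply: sumr_ge0 => k _; first by rewrite addr_ge0 ?sqr_ge0.
by apply: sumr_ge0 => k' _; rewrite addr_ge0 ?sqr_ge0.
Qed.

Lemma ip_self_eq0 n (A : 'M[C]_n) : selfadj A -> ip A A <= 0 -> A = 0.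
Proof.
move=> sA h; apply/matrixP => i j; have := le_trans (entry_le_ip i j sA) h.
move=> {}h; rewrite mxE; apply: complexP => /=; nra.
Qed.

Lemma psd_ip_self n (A : 'M[C]_n) : psd A -> ip A A <= trR A ^+ 2.
Proof.
move=> pA; apply: le_trans (ip_mono pA (mxle_tr1 pA)) _.
by rewrite ipZr ipC ip1l expr2.
Qed.

Lemma psd_tr_eq0 n (A : 'M[C]_n) : psd A -> trR A <= 0 -> A = 0.
Proof.
move=> pA h; apply: ip_self_eq0; first by case: pA.
apply: le_trans (psd_ip_self pA) _; have := psd_tr_ge0 pA; nra.
Qed.

Lemma psd_tr_gt0 n (A : 'M[C]_n) : psd A -> A != 0 -> 0 < trR A.
Proof.
move=> pA; apply: contraNT; rewrite -leNgt => h; exact/eqP/psd_tr_eq0.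
Qed.

Lemma psd_entry_bound n (A : 'M[C]_n) i j : psd A ->
  `|complex.Re (A i j)| <= trR A /\ `|complex.Im (A i j)| <= trR A.
Proof.
move=> pA; have t0 := psd_tr_ge0 pA.
have := le_trans (entry_le_ip i j (psd_selfadj pA)) (psd_ip_self pA).
by split; rewrite ler_norml; apply/andP; split; nra.
Qed.

Lemma psd_trE n (A : 'M[C]_n) : psd A -> \tr A = (trR A)%:C%C.
Proof.
move=> pA; apply: complexP => //=; rewrite /mxtrace.
have : 0 <= \sum_i A i i by apply: sumr_ge0 => i _; apply: psd_diag_ge0.
by rewrite ge0_ReIm => /andP[/eqP].
Qed.

Lemma densityE n (A : 'M[C]_n) : density A <-> psd A /\ trR A = 1.
Proof.
split=> [[pA t]|[pA t]]; first by split=> //; rewrite t.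
by split=> //; rewrite psd_trE // t.
Qed.

Lemma density_neq0 n (A : 'M[C]_n) : density A -> A != 0.
Proof.
by move=> [_ t]; apply/eqP => A0; move: t; rewrite A0 mxtrace0 => /esym/eqP; rewrite oner_eq0.
Qed.

Lemma mxle_refl n (A : 'M[C]_n) : mxle A A.
Proof. by rewrite /mxle subrr; apply: psd0. Qed.

Lemma mxle_trans n (B A D : 'M[C]_n) : mxle A B -> mxle B D -> mxle A D.
Proof.
rewrite /mxle => h k; have := psdD h k.
by have -> : B - A + (D - B) = D - A by rewrite addrC addrA subrK.
Qed.

Lemma mxle_anti n (A B : 'M[C]_n) : mxle A B -> mxle B A -> A = B.
Proof.
move=> h /mxle_tr k; apply/esym/eqP; rewrite -subr_eq0; apply/eqP.
by apply: psd_tr_eq0 => //; rewrite trRB subr_le0.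
Qed.

Lemma mxleD n (A B D E : 'M[C]_n) : mxle A B -> mxle D E -> mxle (A + D) (B + E).
Proof. by rewrite /mxle => h k; rewrite opprD addrACA; apply: psdD. Qed.

Lemma mxleZ n l (A B : 'M[C]_n) : 0 <= l -> mxle A B -> mxle (rscale l A) (rscale l B).
Proof. by rewrite /mxle -rscalerN -rscaleDr; apply: psdZ. Qed.

Lemma mxleZl n l m (A : 'M[C]_n) : l <= m -> psd A -> mxle (rscale l A) (rscale m A).
Proof. by move=> lm pA; rewrite /mxle -rscaleNr -rscaleDl; apply: psdZ => //; rewrite subr_ge0. Qed.

Lemma mxle0 n (A : 'M[C]_n) : mxle 0 A <-> psd A.
Proof. by rewrite /mxle subr0. Qed.

Lemma density_le1 n (A : 'M[C]_n) : density A -> mxle A 1%:M.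
Proof. by move=> /densityE[pA t]; have := mxle_tr1 pA; rewrite t rscale1. Qed.

(* Testing against the rank-one operators [v v^*]. *)
Lemma psd_ipP n (A : 'M[C]_n) : selfadj A ->
  (forall P, psd P -> 0 <= ip A P) -> psd A.
Proof.
move=> sA h; apply: psdP => // v; rewrite qform_ip; apply: h.
by have := psd_gram (adjmx v); rewrite adjmxK.
Qed.

(** With [A = X^* X] the hypothesis reads [(X N)^* (X N) = 0], whose diagonal entries are the
    squared lengths of the columns of [X N]. *)
Lemma psd_kernel n m (A : 'M[C]_n) (N : 'M[C]_(n, m)) :
  psd A -> adjmx N *m A *m N = 0 -> A *m N = 0.
Proof.
move=> /psd_gramP[X ->] h; suff XN : X *m N = 0 by rewrite -mulmxA XN mulmx0.
have : adjmx (X *m N) *m (X *m N) = 0 by rewrite adjmxM !mulmxA -mulmxA -[RHS]h !mulmxA.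
move: (X *m N) => Y Y0; apply/matrixP => i j.
have /matrixP /(_ j j) := Y0; rewrite !mxE => /eqP.
rewrite psumr_eq0 => [/allP /(_ i (mem_index_enum _))|k _]; last first.
  by rewrite !mxE mulrC mul_conjC_ge0.
by rewrite !mxE mulf_eq0 conjC_eq0 orbb => /eqP.
Qed.

(** Sandwiching between [N^*] and [N], with [N] the cokernel of [B], kills the upper bound and
    squeezes [N^* A N] to zero. *)
Lemma submx_mxle n l (A B : 'M[C]_n) : psd A -> mxle A (rscale l B) -> (A <= B)%MS.
Proof.
move=> pA h; rewrite submxE; apply/eqP/psd_kernel => //.
set N := cokermx B; have BN : B *m N = 0 by apply: mulmx_coker.
have p1 := psd_congr N pA; have := psd_congr N h.
rewrite mulmxBr mulmxBl /rscale -scalemxAr -scalemxAl -[_ *m B *m N]mulmxA BN.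
rewrite mulmx0 scaler0 => p2; apply: mxle_anti; rewrite ?mxle0 //.
Qed.

(* With [A = X^* X] and [B = Y^* Y], range inclusion gives [X = G Y], hence
   [A = Y^* (G^* G) Y <= tr (G^* G) B]. *)
Lemma mxle_submx n (A B : 'M[C]_n) : psd A -> psd B -> (A <= B)%MS ->
  exists2 l, 0 <= l & mxle A (rscale l B).
Proof.
move=> pA pB /submxP[D eA].
have [X eX] := psd_gramP pA; have [Y eY] := psd_gramP pB.
have /submxP[G eG] : (X <= Y)%MS.
  rewrite submxE; set N := cokermx Y; have YN : Y *m N = 0 by apply: mulmx_coker.
  have AN : A *m N = 0 by rewrite eA eY -!mulmxA YN !mulmx0.
  apply/eqP; have := @psd_kernel _ _ 1%:M (X *m N) (psd1 _).
  rewrite mulmx1 mul1mx; apply.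
  by rewrite adjmxM -mulmxA [adjmx X *m _]mulmxA -eX AN mulmx0.
have pG := psd_gram G; exists (trR (adjmx G *m G)); first exact: psd_tr_ge0.
have := psd_congr Y (mxle_tr1 pG); rewrite /mxle mulmxBr mulmxBl.
rewrite /rscale -scalemxAr -scalemxAl mulmx1 -eY.
by rewrite [X in _ -> psd (_ - X)]eX eG adjmxM !mulmxA.
Qed.

(** [same_support] compares column spaces, the domination lemmas row spaces. For self-adjoint
    operators the transpose is the entrywise conjugate, and conjugation preserves inclusion of row
    spaces. *)
Lemma same_supportP n (A B : 'M[C]_n) : selfadj A -> selfadj B ->
  same_support A B <-> (A <= B)%MS /\ (B <= A)%MS.
Proof.
have e D : selfadj D -> D^T = map_mx Num.conj D.
  by move=> {1}<-; apply/matrixP => i j; rewrite !mxE.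
move=> sA sB; rewrite /same_support !e // !map_submx.
by split=> [/andP|[-> ->]].
Qed.

End Operators.

(** * Entrywise limits and compactness *)

Section Convergence.
Variable R : realType.
Local Notation C := R[i].
Local Notation trR A := (complex.Re (\tr A)).

Definition cvgC (u : nat -> C) (a : C) : Prop :=
  ((fun k => complex.Re (u k)) @ \oo --> complex.Re a) /\
  ((fun k => complex.Im (u k)) @ \oo --> complex.Im a).

Lemma cvgC_cst a : cvgC (fun=> a) a.
Proof. by split; apply: cvg_cst. Qed.

Lemma cvgCD u v a b : cvgC u a -> cvgC v b -> cvgC (fun k => u k + v k) (a + b).
Proof.
move=> [ur ui] [vr vi]; split.
  rewrite ReD; under eq_fun do rewrite ReD; exact: cvgD.
rewrite ImD; under eq_fun do rewrite ImD; exact: cvgD.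
Qed.

Lemma cvgCM u v a b : cvgC u a -> cvgC v b -> cvgC (fun k => u k * v k) (a * b).
Proof.
move=> [ur ui] [vr vi]; split.
  rewrite ReME; under eq_fun do rewrite ReME; apply: cvgB; exact: cvgM.
rewrite ImME; under eq_fun do rewrite ImME; apply: cvgD; exact: cvgM.
Qed.

Lemma cvgC_conj u a : cvgC u a -> cvgC (fun k => Num.conj (u k)) (Num.conj a).
Proof.
move=> [ur ui]; split.
  by rewrite Re_conjE; under eq_fun do rewrite Re_conjE.
by rewrite Im_conjE; under eq_fun do rewrite Im_conjE; exact: cvgN.
Qed.

Lemma cvgC_real (l : nat -> R) (a : R) : l @ \oo --> a -> cvgC (fun k => (l k)%:C%C) a%:C%C.
Proof. by move=> h; split=> //=; apply: cvg_cst. Qed.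

Lemma cvgC_sum (I : Type) (r : seq I) (u : I -> nat -> C) (a : I -> C) :
  (forall i, cvgC (u i) (a i)) -> cvgC (fun k => \sum_(i <- r) u i k) (\sum_(i <- r) a i).
Proof.
move=> h; elim: r => [|i r ih].
  by rewrite big_nil; under eq_fun do rewrite big_nil; apply: cvgC_cst.
by rewrite big_cons; under eq_fun do rewrite big_cons; apply: cvgCD.
Qed.

Lemma cvgC_unique u a b : cvgC u a -> cvgC u b -> a = b.
Proof.
move=> [ar ai] [br bi]; apply: complexP.
  exact: cvg_unique ar br.
exact: cvg_unique ai bi.
Qed.

Lemma mx_cvgP n (u : nat -> 'M[C]_n) a :
  mx_cvg u a <-> forall i j, cvgC (fun k => u k i j) (a i j).
Proof. by []. Qed.

Lemma mx_cvg_cst n (a : 'M[C]_n) : mx_cvg (fun=> a) a.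
Proof. by move=> i j; apply: cvgC_cst. Qed.

Lemma mx_cvgD n (u v : nat -> 'M[C]_n) a b :
  mx_cvg u a -> mx_cvg v b -> mx_cvg (fun k => u k + v k) (a + b).
Proof.
move=> ua vb; apply/mx_cvgP => i j; rewrite mxE.
by under eq_fun do rewrite mxE; apply: cvgCD; [exact: ua|exact: vb].
Qed.

Lemma mx_cvgZ n (l : nat -> R) (m : R) (u : nat -> 'M[C]_n) a :
  l @ \oo --> m -> mx_cvg u a -> mx_cvg (fun k => rscale (l k) (u k)) (rscale m a).
Proof.
move=> lm ua; apply/mx_cvgP => i j; rewrite mxE.
by under eq_fun do rewrite mxE; apply: cvgCM; [exact: cvgC_real|exact: ua].
Qed.

Lemma mx_cvgN n (u : nat -> 'M[C]_n) a : mx_cvg u a -> mx_cvg (fun k => - u k) (- a).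
Proof.
move=> ua; have c : (fun=> -1 : R) @ \oo --> (-1 : R) by exact: cvg_cst.
have := mx_cvgZ c ua.
by rewrite rscaleNr rscale1; under eq_fun do rewrite rscaleNr rscale1.
Qed.

Lemma mx_cvgB n (u v : nat -> 'M[C]_n) a b :
  mx_cvg u a -> mx_cvg v b -> mx_cvg (fun k => u k - v k) (a - b).
Proof. by move=> ua /mx_cvgN; apply: mx_cvgD. Qed.

Lemma ip_cvg n (u v : nat -> 'M[C]_n) a b :
  mx_cvg u a -> mx_cvg v b -> (fun k => ip (u k) (v k)) @ \oo --> ip a b.
Proof.
move=> ua vb; suff [//] : cvgC (fun k => \tr (u k *m v k)) (\tr (a *m b)).
apply: cvgC_sum => i; rewrite mxE; under eq_fun do rewrite mxE.
by apply: cvgC_sum => j; apply: cvgCM; [exact: ua|exact: vb].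
Qed.

Lemma selfadj_closed n (u : nat -> 'M[C]_n) a :
  (forall k, selfadj (u k)) -> mx_cvg u a -> selfadj a.
Proof.
move=> su ua; apply/matrixP => i j; rewrite adjmxE.
apply: (@cvgC_unique (fun k => u k i j)); last exact: ua.
under eq_fun => k do rewrite -[u k]su adjmxE.
by apply: cvgC_conj; apply: ua.
Qed.

Lemma cvg_ge0 (u : nat -> R) (a : R) : (forall k, 0 <= u k) -> u @ \oo --> a -> 0 <= a.
Proof.
move=> u0 ua; rewrite -(cvg_lim (@norm_hausdorff _ _) ua).
apply: limr_ge; first by apply/cvg_ex; exists a.
exact: nearW.
Qed.

Lemma psd_closed n (u : nat -> 'M[C]_n) a :
  (forall k, psd (u k)) -> mx_cvg u a -> psd a.
Proof.
move=> pu ua; apply: psd_ipP.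
  by apply: selfadj_closed ua => k; case: (pu k).
move=> P pP; apply: cvg_ge0 (ip_cvg ua (mx_cvg_cst P)) => k; exact: ip_ge0.
Qed.

Lemma mxle_closed n (u v : nat -> 'M[C]_n) a b :
  (forall k, mxle (u k) (v k)) -> mx_cvg u a -> mx_cvg v b -> mxle a b.
Proof. by move=> h ua vb; apply: psd_closed h _; apply: mx_cvgB. Qed.

Lemma tr_cvg n (u : nat -> 'M[C]_n) a : mx_cvg u a ->
  (fun k => trR (u k)) @ \oo --> trR a.
Proof.
move=> ua; have := ip_cvg (mx_cvg_cst 1%:M) ua.
by rewrite ip1l; under eq_fun do rewrite ip1l.
Qed.

Lemma density_closed n (u : nat -> 'M[C]_n) a :
  (forall k, density (u k)) -> mx_cvg u a -> density a.
Proof.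
move=> du ua; apply/densityE; split.
  by apply: psd_closed ua => k; case: (du k).
have := tr_cvg ua; under eq_fun => k do rewrite (proj2 (proj1 (densityE _) (du k))).
move=> h; apply: (cvg_unique _ h); [exact: norm_hausdorff|exact: cvg_cst].
Qed.

(** The condition [k <= f k] alone preserves limits. It is stable under composition and is all that
    a choice of arbitrarily late indices yields, so subsequences are carried in this form. *)
Lemma cvg_subseq (u : nat -> R) (a : R) (f : nat -> nat) :
  (forall k, (k <= f k)%N) -> u @ \oo --> a -> (u \o f) @ \oo --> a.
Proof.
move=> hf; apply: cvg_comp => A [N _ hA]; exists N => // k /= Nk.
by apply: hA => /=; apply: leq_trans (hf k).
Qed.

Lemma mx_cvg_subseq n (u : nat -> 'M[C]_n) a (f : nat -> nat) :
  (forall k, (k <= f k)%N) -> mx_cvg u a -> mx_cvg (u \o f) a.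
Proof.
move=> hf ua i j; have [h1 h2] := ua i j; split.
  exact: (cvg_subseq hf h1).
exact: (cvg_subseq hf h2).
Qed.

Lemma increasing_seq_ge (f : nat -> nat) : increasing_seq f -> forall k, (k <= f k)%N.
Proof.
move=> /increasing_seqP hf; elim=> // k ih.
by apply: leq_ltn_trans ih (hf k).
Qed.

Lemma bolzano_weierstrass_seq (I : eqType) (r : seq I) (u : I -> nat -> R) :
  (forall i, exists M, forall k, `|u i k| <= M) ->
  exists2 f : nat -> nat, (forall k, (k <= f k)%N) &
    forall i, i \in r -> exists a : R, (u i \o f) @ \oo --> a.
Proof.
move=> ub; elim: r => [|i r [f hf ih]]; first by exists id.
have [|g /increasing_seq_ge hg /cvg_ex [a ga]] := @bolzano_weierstrass R (u i \o f).
  have [M hM] := ub i; exists M; split; first exact: num_real.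
  by move=> x Mx k _ /=; apply: le_trans (hM _) (ltW Mx).
exists (f \o g); first by move=> k; apply: leq_trans (hg k) (hf _).
move=> j; rewrite inE => /orP[/eqP -> | /ih [b hb]]; first by exists a.
by exists b; apply: (cvg_subseq hg hb).
Qed.

(** Real and imaginary parts of all entries of all members form one finite family of bounded real
    sequences, so a single subsequence serves several operators at once. *)
Lemma bolzano_weierstrass_mx (I : finType) n (u : I -> nat -> 'M[C]_n) :
  (forall i, exists M, forall k, psd (u i k) /\ trR (u i k) <= M) ->
  exists2 f : nat -> nat, (forall k, (k <= f k)%N) &
    exists a : I -> 'M[C]_n, forall i, mx_cvg (u i \o f) (a i).
Proof.
move=> ub.
pose w (x : I * ('I_n * 'I_n) * bool) k : R :=
  let z := u x.1.1 k x.1.2.1 x.1.2.2 in if x.2 then complex.Re z else complex.Im z.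
have wb x : exists M, forall k, `|w x k| <= M.
  case: x => [[i [p q]] b]; have [M hM] := ub i; exists M => k.
  have [pu uM] := hM k; have [h1 h2] := psd_entry_bound p q pu.
  by rewrite /w /=; case: b; apply: le_trans uM.
have [f hf hw] := bolzano_weierstrass_seq (index_enum _) wb; exists f => //.
have /choice [l hl] x : exists a : R, (w x \o f) @ \oo --> a.
  by apply: hw; rewrite mem_index_enum.
exists (fun i => \matrix_(p, q) (l (i, (p, q), true) +i* l (i, (p, q), false))%C).
move=> i p q; rewrite mxE /=; split.
  exact: (hl (i, (p, q), true)).
exact: (hl (i, (p, q), false)).
Qed.

End Convergence.

(** * The conic form of the projective robustness *)

Section ProjectiveRobustness.
Variable R : realType.
Local Notation C := R[i].
Local Notation trR A := (complex.Re (\tr A)).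

(** Replaces a possibly infinite upper bound by the reals strictly above it; when the bound is an
    infimum, each such real comes with a feasible point. *)
Lemma lee_lt_fin (x y : \bar R) :
  (forall g : R, (y < g%:E)%E -> (x <= g%:E)%E) -> (x <= y)%E.
Proof.
case: y => [r| |] h; first last.
- case: x h => [r| |] h //; first by have {h} := h (r - 1) (ltNyr _); rewrite lee_fin => h; exfalso; lra.
  by have := h 0 (ltNyr _).
- exact: leey.
apply/lee_addgt0Pr => e e0; rewrite -EFinD; apply: h.
by rewrite lte_fin ltrDl.
Qed.

Lemma mule_lty (a b c : \bar R) : (0 < a)%E -> (0 < b)%E -> (a * b < c)%E ->
  (a < +oo)%E /\ (b < +oo)%E.
Proof.
move=> a0 b0; case: a a0 => [a| |] // a0; last by rewrite gt0_mulye // ltNge leey.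
case: b b0 => [b| |] // b0; last by rewrite gt0_muley // ltNge leey.
by move=> _; split; apply: ltry.
Qed.

Lemma harmonic_cvg (l : R) : (fun k => l + harmonic k) @ \oo --> l.
Proof.
rewrite -[X in _ --> X]addr0; apply: cvgD; first exact: cvg_cst.
exact: cvg_harmonic.
Qed.

Section Dim.
Variable n : nat.
Implicit Types (X Y rho s st : 'M[C]_n) (F : set 'M[C]_n) (l g : R).

Lemma Rmax_ge0 X Y : (0 <= Rmax X Y)%E.
Proof. by apply/ereal_infP => _ [l [l0 _] <-]; rewrite lee_fin. Qed.

Lemma Rmax_le X Y l : 0 <= l -> mxle X (rscale l Y) -> (Rmax X Y <= l%:E)%E.
Proof. by move=> l0 h; apply: ereal_inf_lbound; exists l. Qed.

(** The relation is monotone in the factor because [Y] is positive, so every [l + harmonic k] is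
    admissible, and the order is closed under limits. *)
Lemma Rmax_attained X Y : psd Y -> (Rmax X Y < +oo)%E ->
  exists l, [/\ 0 <= l, Rmax X Y = l%:E & mxle X (rscale l Y)].
Proof.
move=> pY h; have fR : Rmax X Y \is a fin_num by rewrite ge0_fin_numE ?Rmax_ge0.
exists (fine (Rmax X Y)); rewrite fineK // fine_ge0 ?Rmax_ge0 //; split=> //.
set l := fine _.
have hk k : mxle X (rscale (l + harmonic k) Y).
  have : (Rmax X Y < (l + harmonic k)%:E)%E.
    by rewrite -(fineK fR) lte_fin ltrDl harmonic_gt0.
  move=> /ereal_inf_lt [_ [m [m0 hm] <-]]; rewrite lte_fin => /ltW ml.
  exact: mxle_trans hm (mxleZl ml pY).
apply: (mxle_closed hk); first exact: mx_cvg_cst.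
by apply: mx_cvgZ; [exact: harmonic_cvg|exact: mx_cvg_cst].
Qed.

Lemma Rmax_gt0 X Y : psd X -> X != 0 -> psd Y -> (0 < Rmax X Y)%E.
Proof.
move=> pX X0 pY; rewrite lt_neqAle Rmax_ge0 andbT; apply/eqP => e0.
have [|l [_ el]] := @Rmax_attained X Y pY; first by rewrite -e0 ltry.
have -> : l = 0 by apply/EFin_inj; rewrite -el -e0.
by rewrite rscale0 => /mxle_tr; rewrite mxtrace0 leNgt psd_tr_gt0.
Qed.

Lemma Rmax_ge1 X Y : density X -> density Y -> (1 <= Rmax X Y)%E.
Proof.
move=> /densityE[_ tX] /densityE[_ tY]; apply/ereal_infP => _ [l [_ h] <-].
by rewrite lee_fin; move/mxle_tr: h; rewrite trRZ tX tY mulr1.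
Qed.

Lemma Rmax_scalel X Y l : 0 < l -> Rmax (rscale l X) Y = (l%:E * Rmax X Y)%E.
Proof.
suff h (m : R) (Z : 'M[C]_n) : 0 < m -> (Rmax (rscale m Z) Y <= m%:E * Rmax Z Y)%E.
  move=> l0; apply/eqP; rewrite eq_le h //=.
  have li : 0 < l^-1 by rewrite invr_gt0.
  have := h l^-1 (rscale l X) li; rewrite rscaleA mulVf ?gt_eqF // rscale1.
  move=> /(lee_wpmul2l (ltW (_ : (0 < l%:E)%E))); rewrite lte_fin => /(_ l0).
  by rewrite muleA -EFinM divff ?gt_eqF // mul1e.
move=> m0; rewrite -lee_pdivrMl //; apply/ereal_infP => _ [l' [l0 hl] <-].
rewrite lee_pdivrMl // -EFinM; apply: Rmax_le; first by rewrite mulr_ge0 // ltW.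
by rewrite -rscaleA; apply: mxleZ => //; apply: ltW.
Qed.

Lemma Rmax_scaler X Y l : 0 < l -> Rmax X (rscale l Y) = (l^-1%:E * Rmax X Y)%E.
Proof.
move=> l0; have li : 0 < l^-1 by rewrite invr_gt0.
have e (m : R) : mxle X (rscale m (rscale l Y)) <-> mxle (rscale l^-1 X) (rscale m Y).
  rewrite rscaleA [m * l]mulrC -rscaleA; split=> h.
    by have := mxleZ (ltW li) h; rewrite (rscaleK _ l0).
  by have := mxleZ (ltW l0) h; rewrite (rscaleVK _ l0).
rewrite -(Rmax_scalel X Y li); apply: (congr1 (@ereal_inf R)).
apply/seteqP; split=> _ [m [m0 h] <-]; exists m; split; try exact: m0.
- exact/e.
- exact/e.
Qed.

Lemma Omega_scale F rho l : 0 < l -> Omega F (rscale l rho) = Omega F rho.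
Proof.
move=> l0.
have e s : (Rmax (rscale l rho) s * Rmax s (rscale l rho))%E = (Rmax rho s * Rmax s rho)%E.
  rewrite (Rmax_scalel _ _ l0) (Rmax_scaler _ _ l0).
  move: (Rmax rho s) (Rmax s rho) => a b.
  by rewrite [(l%:E * a)%E]muleC -muleA [(l%:E * _)%E]muleA -EFinM divff ?gt_eqF // mul1e.
rewrite /Omega; apply: (congr1 (@ereal_inf R)).
apply/seteqP; split=> _ [s Fs <-]; exists s; first exact: Fs.
- exact: esym (e s).
- exact: Fs.
- exact: e s.
Qed.

Lemma Omega_ge0 F rho : (0 <= Omega F rho)%E.
Proof. by apply/ereal_infP => _ [s _ <-]; rewrite mule_ge0 ?Rmax_ge0. Qed.

Lemma Omega_ge1 F rho : F `<=` @density R n -> density rho -> (1 <= Omega F rho)%E.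
Proof.
move=> dF dr; apply/ereal_infP => _ [s Fs <-].
by rewrite -[X in (X <= _)%E]mule1 lee_pmul ?lee01 ?Rmax_ge1 //; apply: dF.
Qed.

(** The two factors are at most [l] and [g / l]; the scale [l] cancels in their product. *)
Lemma Omega_le F rho s l g : F s -> 0 < l -> 0 <= g ->
  mxle rho (rscale l s) -> mxle (rscale l s) (rscale g rho) ->
  (Omega F rho <= g%:E)%E.
Proof.
move=> Fs l0 g0 h1 h2.
have li : 0 <= l^-1 by rewrite invr_ge0 ltW.
have h3 : mxle s (rscale (g / l) rho).
  by have := mxleZ li h2; rewrite (rscaleK _ l0) rscaleA mulrC.
have gl : 0 <= g / l by rewrite divr_ge0 // ltW.
apply: (@le_trans _ _ (Rmax rho s * Rmax s rho)%E).
  by apply: ereal_inf_lbound; exists s.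
have -> : g%:E = (l%:E * (g / l)%:E)%E.
  by rewrite -EFinM mulrCA divff ?gt_eqF // mulr1.
by apply: lee_pmul; rewrite ?Rmax_ge0 ?Rmax_le // ltW.
Qed.

(** Both factors of a product below [g] are positive, hence finite and attained; scaling [s] by the
    first factor gives the two-sided bound. *)
Lemma Omega_lt F rho g : F `<=` @density R n -> psd rho -> rho != 0 ->
  (Omega F rho < g%:E)%E ->
  exists l s, [/\ 0 < l, F s, mxle rho (rscale l s) & mxle (rscale l s) (rscale g rho)].
Proof.
move=> dF pr r0 /ereal_inf_lt [_ [s Fs <-]] h.
have ds := dF _ Fs; have [ps _] := ds; have s0 := density_neq0 ds.
have a0 := Rmax_gt0 pr r0 ps; have b0 := Rmax_gt0 ps s0 pr.
have [ay b_y] := mule_lty a0 b0 h.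
have [l [l0 el hl]] := Rmax_attained ps ay.
have [m [m0 em hm]] := Rmax_attained pr b_y.
exists l, s; split; [by move: a0; rewrite el lte_fin|exact: Fs|exact: hl|].
apply: mxle_trans (mxleZ l0 hm) _; rewrite rscaleA; apply: mxleZl => //.
by move: h; rewrite el em -EFinM lte_fin => /ltW.
Qed.

Lemma cone_psd F st : F `<=` @density R n -> cone F st -> psd st.
Proof. by move=> dF [l [s [l0 [Fs ->]]]]; apply: psdZ => //; case: (dF _ Fs). Qed.

Lemma cone_rscale F l st : 0 <= l -> cone F st -> cone F (rscale l st).
Proof.
move=> l0 [m [s [m0 [Fs ->]]]]; exists (l * m), s.
by rewrite rscaleA mulr_ge0.
Qed.

Lemma cone_add F st st' : mx_convex F -> cone F st -> cone F st' -> cone F (st + st').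
Proof.
move=> cF [l [s [l0 [Fs ->]]]] [m [t [m0 [Ft ->]]]].
(* The weight [l / (l + m)] needs a nonzero sum; when the sum vanishes, both terms are zero. *)
have [lm|lm] := eqVneq (l + m) 0.
  have -> : l = 0 by lra.
  have -> : m = 0 by lra.
  by exists 0, s; rewrite !rscale0 addr0.
have lm0 : 0 < l + m by rewrite lt_neqAle eq_sym lm addr_ge0.
exists (l + m), (rscale (l / (l + m)) s + rscale (1 - l / (l + m)) t).
split; first exact: ltW.
split.
  apply: cF => //; rewrite divr_ge0 ?(ltW lm0) //= ler_pdivrMr // mul1r.
  by rewrite lerDl.
rewrite rscaleDr !rscaleA; congr (rscale _ _ + rscale _ _); field; exact: lm.
Qed.

Lemma Omega_le_cone F rho st g : F `<=` @density R n -> psd rho -> rho != 0 ->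
  cone F st -> mxle rho st -> mxle st (rscale g rho) -> (Omega F rho <= g%:E)%E.
Proof.
move=> dF pr r0 [l [s [l0 [Fs ->]]]] h1 h2.
have t0 := psd_tr_gt0 pr r0; have /densityE[_ ts] := dF _ Fs.
(* Comparing traces gives [tr rho <= l <= g * tr rho], which makes [l] positive and [g]
   nonnegative. *)
have t1 := mxle_tr h1; have t2 := mxle_tr h2.
move: t1 t2; rewrite !trRZ ts mulr1 => t1 t2.
by apply: (Omega_le Fs _ _ h1 h2); [lra|nra].
Qed.

Lemma Omega_lt_cone F rho g : F `<=` @density R n -> psd rho -> rho != 0 ->
  (Omega F rho < g%:E)%E -> exists st, cone F st /\ mxle rho st /\ mxle st (rscale g rho).
Proof.
move=> dF pr r0 /(Omega_lt dF pr r0) [l [s [l0 Fs h1 h2]]].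
exists (rscale l s); split; last exact: conj h1 h2.
exists l, s; split; first exact: ltW.
by split; first exact: Fs.
Qed.

Lemma Omega_conic F rho : F `<=` @density R n -> psd rho -> rho != 0 ->
  Omega F rho = ereal_inf [set g%:E | g in [set g : R | exists st,
              cone F st /\ mxle rho st /\ mxle st (rscale g rho)]].
Proof.
move=> dF pr r0; apply/eqP; rewrite eq_le; apply/andP; split.
  by apply/ereal_infP => _ [g [st [cs [h1 h2]]] <-]; apply: (Omega_le_cone dF pr r0 cs h1 h2).
apply: lee_lt_fin => g /(Omega_lt_cone dF pr r0) h.
by apply: ereal_inf_lbound; exists g.
Qed.

Lemma mx_cvg_unique (u : nat -> 'M[C]_n) a b : mx_cvg u a -> mx_cvg u b -> a = b.
Proof.
move=> ua ub; apply/matrixP => i j.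
by apply: (@cvgC_unique _ (fun k => u k i j)); [exact: ua|exact: ub].
Qed.

(** Free states have trace one, so the coefficient of a cone element is its trace. The coefficients
    thus converge by themselves, and compactness is needed only for the states. *)
Lemma cone_closed F (u : nat -> 'M[C]_n) a :
  free_set F -> (forall k, cone F (u k)) -> mx_cvg u a -> cone F a.
Proof.
move=> [dF cF] /choice [l hl] ua.
have /choice [s hs] k : exists s, 0 <= l k /\ F s /\ u k = rscale (l k) s.
  by have [s hs] := hl k; exists s.
have Fs k : F (s k) by case: (hs k) => _ [].
have bd k : psd (s k) /\ trR (s k) <= 1.
  by have /densityE[ps ->] := dF _ (Fs k).
have [f hf [b hb]] := @bolzano_weierstrass_mx R unit n (fun=> s)
  (fun=> ex_intro _ 1 bd).
have {b hb}[b hb] : exists b, mx_cvg (s \o f) b by exists (b tt); apply: hb.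
have Fb : F b by apply: cF hb => k; apply: Fs.
have ul k : l k = trR (u k).
  have [_ [Fk ->]] := hs k; have /densityE[_ t] := dF _ Fk.
  by rewrite trRZ t mulr1.
have lc := cvg_subseq hf (tr_cvg ua).
exists (trR a), b; split; last split=> //.
  by apply: cvg_ge0 lc => k /=; rewrite -ul; case: (hs (f k)).
apply: (mx_cvg_unique (mx_cvg_subseq hf ua)).
have -> : u \o f = fun k => rscale (trR (u (f k))) (s (f k)).
  by apply/funext => k /=; rewrite -ul; case: (hs (f k)) => _ [].
exact: mx_cvgZ lc hb.
Qed.

(** Serves both attainment, where [u] is constant and [g k] tends to the infimum, and lower
    semicontinuity, where [g] is constant. The common bound [M] provides a convergent subsequence of
    the [st]. *)
Lemma feasible_closed F (u : nat -> 'M[C]_n) rho (g : nat -> R) (g0 M : R) :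
  free_set F -> mx_cvg u rho -> g @ \oo --> g0 ->
  (forall k, exists st, trR st <= M /\
     cone F st /\ mxle (u k) st /\ mxle st (rscale (g k) (u k))) ->
  exists st, cone F st /\ mxle rho st /\ mxle st (rscale g0 rho).
Proof.
move=> fF ur gg /choice [st hst].
have [f hf [b hb]] := @bolzano_weierstrass_mx R unit n (fun=> st)
  (fun=> ex_intro _ M (fun k => conj (cone_psd fF.1 (hst k).2.1) (hst k).1)).
have {b hb}[b hb] : exists b, mx_cvg (st \o f) b by exists (b tt); apply: hb.
have uf := mx_cvg_subseq hf ur; exists b; split; last split.
- by apply: cone_closed hb => // k; apply: (hst (f k)).2.1.
- by apply: mxle_closed uf hb => k; apply: (hst (f k)).2.2.1.
- apply: (@mxle_closed _ _ _ (fun k => rscale (g (f k)) (u (f k))) _ _ _ hb).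
    by move=> k; apply: (hst (f k)).2.2.2.
  exact: mx_cvgZ (cvg_subseq hf gg) uf.
Qed.

Lemma Omega_attained F rho : free_set F -> psd rho -> rho != 0 ->
  (Omega F rho < +oo)%E -> exists (g : R) st,
  cone F st /\ mxle rho st /\ mxle st (rscale g rho) /\ Omega F rho = g%:E.
Proof.
move=> fF pr r0 h; have [dF _] := fF.
have fR : Omega F rho \is a fin_num by rewrite ge0_fin_numE ?Omega_ge0.
set g := fine (Omega F rho); have g0 : 0 <= g by rewrite fine_ge0 ?Omega_ge0.
(* Since [harmonic k <= 1], each [st] feasible at level [g + harmonic k] has trace at most
   [(g + 1) * tr rho]. *)
have [] := @feasible_closed F (fun=> rho) rho (fun k => g + harmonic k) g
  ((g + 1) * trR rho) fF (mx_cvg_cst rho) (@harmonic_cvg g).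
  move=> k; have : (Omega F rho < (g + harmonic k)%:E)%E.
    by rewrite -(fineK fR) lte_fin ltrDl harmonic_gt0.
  move=> /(Omega_lt_cone dF pr r0) [st [c [h1 h2]]]; exists st; split; last exact: conj c (conj h1 h2).
  apply: le_trans (mxle_tr h2) _; rewrite trRZ ler_wpM2r ?psd_tr_ge0 //.
  by rewrite lerD2l /harmonic /= invf_le1 ?ler1n ?ltr0n.
move=> st [c [h1 h2]]; exists g, st; split; first exact: c.
by split; [exact: h1|split; [exact: h2|rewrite fineK]].
Qed.

Lemma Omega_lsc F (u : nat -> 'M[C]_n) rho : free_set F ->
  (forall k, density (u k)) -> mx_cvg u rho ->
  (Omega F rho <= limn_einf (fun k => Omega F (u k)))%E.
Proof.
move=> fF du ur; have [dF _] := fF; apply: lee_lt_fin => g hg.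
(* Were all values from some index on at least [g], so would be the tail infima and their limit. *)
have /choice [f hf] N : exists k, (N <= k)%N /\ (Omega F (u k) < g%:E)%E.
  apply: contrapT => hN; move: hg; apply/negP; rewrite -leNgt limn_einf_lim.
  apply: lime_ge; first exact: is_cvg_einfs.
  exists N => // m /= Nm; apply/ereal_infP => _ [k /= mk <-].
  by rewrite leNgt; apply/negP => hk; apply: hN; exists k; split=> //; apply: leq_trans mk.
have uf := mx_cvg_subseq (fun k => (hf k).1) ur.
have [] := @feasible_closed F (u \o f) rho (fun=> g) g g fF uf (cvg_cst _).
  move=> k; have dk := du (f k); have [pk _] := dk.
  have [st [c [h1 h2]]] := Omega_lt_cone dF pk (density_neq0 dk) (hf k).2.
  exists st; split; last exact: conj c (conj h1 h2).
  apply: le_trans (mxle_tr h2) _.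
  by rewrite trRZ (proj2 (proj1 (densityE _) dk)) mulr1.
have dr := density_closed du ur; have [pr _] := dr.
by move=> st [c [h1 h2]]; apply: (Omega_le_cone dF pr (density_neq0 dr) c h1 h2).
Qed.

(** At value one the attained [st] is squeezed to [rho], and comparing traces shows that its cone
    coefficient is one. *)
Lemma Omega_eq1 F rho : free_set F -> density rho -> (Omega F rho = 1%E <-> F rho).
Proof.
move=> fF dr; have [dF _] := fF; have [pr _] := dr.
split=> [h|Fr].
  have [|g [st [[l [s [l0 [Fs est]]]] [h1 [h2 eg]]]]] :=
    Omega_attained fF pr (density_neq0 dr); first by rewrite h ltry.
  have g1 : g = 1 by apply/EFin_inj; rewrite -eg.
  move: h2; rewrite g1 rscale1 => h2; have e := mxle_anti h1 h2.
  have /densityE[_ ts] := dF _ Fs; have /densityE[_ tr] := dr.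
  have : trR rho = l by rewrite e est trRZ ts mulr1.
  by rewrite tr => l1; rewrite e est -l1 rscale1.
apply/eqP; rewrite eq_le Omega_ge1 // andbT.
by apply: (Omega_le Fr ltr01 ler01); rewrite !rscale1; apply: mxle_refl.
Qed.

Lemma Omega_fin F rho : free_set F -> density rho ->
  ((Omega F rho < +oo)%E <-> exists s, F s /\ same_support s rho).
Proof.
move=> [dF cF] dr; have [pr _] := dr; have r0 := density_neq0 dr; split.
  move=> h; have fR : Omega F rho \is a fin_num by rewrite ge0_fin_numE ?Omega_ge0.
  have [|l [s [l0 Fs h1 h2]]] := @Omega_lt F rho (fine (Omega F rho) + 1) dF pr r0.
    by rewrite -(fineK fR) lte_fin ltrDl.
  exists s; split=> //; have [ps _] := dF _ Fs.
  apply/same_supportP; [exact: psd_selfadj|exact: psd_selfadj|split].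
    set g := (_ + 1) in h2.
    have li : 0 <= l^-1 by rewrite invr_ge0 ltW.
    have := mxleZ li h2; rewrite (rscaleK _ l0) rscaleA.
    exact: submx_mxle ps.
  exact: submx_mxle pr h1.
move=> [s [Fs /same_supportP]]; have ds := dF _ Fs; have [ps _] := ds.
move=> /(_ (psd_selfadj ps) (psd_selfadj pr)) [sr rs].
have [l l0 hl] := mxle_submx pr ps rs; have [m m0 hm] := mxle_submx ps pr sr.
apply: (@le_lt_trans _ _ (l * m)%:E); last exact: ltry.
have c : cone F (rscale l s) by exists l, s; split; [exact: l0|split; first exact: Fs].
apply: (Omega_le_cone dF pr r0 c hl).
by rewrite -rscaleA; apply: mxleZ.
Qed.

Lemma Omega_quasiconvex F rho w (t : R) : free_set F -> mx_convex F ->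
  density rho -> density w -> 0 <= t <= 1 ->
  (Omega F (rscale t rho + rscale (1 - t) w) <= Order.max (Omega F rho) (Omega F w))%E.
Proof.
move=> fF cF dr dw /andP[t0 t1]; have [dF _] := fF.
have [pr _] := dr; have [pw _] := dw; have t1' : 0 <= 1 - t by rewrite subr_ge0.
have /densityE[_ tr] := dr; have /densityE[_ tw] := dw.
apply: lee_lt_fin => g; rewrite gt_max => /andP[].
move=> /(Omega_lt_cone dF pr (density_neq0 dr)) [st [c [h1 h2]]].
move=> /(Omega_lt_cone dF pw (density_neq0 dw)) [st' [c' [h1' h2']]].
apply: (@Omega_le_cone _ _ (rscale t st + rscale (1 - t) st')).
- exact: dF.
- by apply: psdD; apply: psdZ.
- apply/density_neq0/densityE; split; first by apply: psdD; apply: psdZ.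
  by rewrite trRD !trRZ tr tw !mulr1 addrC subrK.
- by apply: (cone_add cF); [apply: cone_rscale t0 c|apply: cone_rscale t1' c'].
- by apply: mxleD; [apply: mxleZ t0 h1|apply: mxleZ t1' h1'].
- rewrite rscaleDr !rscaleA ![g * _]mulrC -!rscaleA.
  by apply: mxleD; [apply: mxleZ t0 h2|apply: mxleZ t1' h2'].
Qed.

End Dim.
End ProjectiveRobustness.

(** * Conic duality for convex free sets *)

Section Duality.
Variable R : realType.
Local Notation C := R[i].
Local Notation trR A := (complex.Re (\tr A)).

Lemma lee_gt_fin (x y : \bar R) :
  (forall g : R, (g%:E < x)%E -> (g%:E <= y)%E) -> (x <= y)%E.
Proof.
move=> h; rewrite -leeN2; apply: lee_lt_fin => g; rewrite lteNl -EFinN => /h.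
by rewrite EFinN leeNl.
Qed.

(** A first-order optimality condition: for small [t] the linear term dominates. The range [t <= 1]
    is what a move towards the apex of a cone allows. *)
Lemma quadratic_ge0 (a b : R) : 0 <= b ->
  (forall t, 0 < t <= 1 -> 0 <= 2 * t * a + t ^+ 2 * b) -> 0 <= a.
Proof.
move=> b0 h; rewrite leNgt; apply/negP => a0.
have ba : 0 < b - a by lra.
(* This [t] gives [t * b = t * a - a], so the quadratic equals [t * a * (1 + t)], which is negative;
   [0 <= b] ensures [t <= 1]. *)
pose t := - a / (b - a).
have t0 : 0 < t by rewrite divr_gt0 // oppr_gt0.
have te : t * (b - a) = - a by rewrite /t divfK // gt_eqF.
have t1 : t <= 1 by rewrite ler_pdivrMr // mul1r; lra.
have := h t; rewrite t0 t1 => /(_ isT); nra.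
Qed.

Section Dim.
Variable n : nat.
Implicit Types (X Y A B P Q rho s st : 'M[C]_n) (F : set 'M[C]_n) (l g : R).

Lemma cone0 F s : F s -> cone F 0.
Proof.
by move=> Fs; exists 0, s; split; [exact: lexx|split; [exact: Fs|rewrite rscale0]].
Qed.

(** Expand [<A - 1, A - 1> >= 0]. This converts a bound on the norm into one on the trace. *)
Lemma tr_le_ip A : selfadj A -> trR A <= (ip A A + ip 1%:M (1%:M : 'M[C]_n)) / 2.
Proof.
move=> sA; have := ip_self_ge0 (selfadjB sA (@selfadj1 R n)).
rewrite !(ipDl, ipDr, ipNl, ipNr) [ip A 1%:M]ipC [ip 1%:M A]ip1l.
lra.
Qed.

Lemma ip_selfD A B (t : R) :
  ip (A + rscale t B) (A + rscale t B) = ip A A + 2 * t * ip A B + t ^+ 2 * ip B B.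
Proof. rewrite !(ipDl, ipDr, ipZl, ipZr) (ipC B A); ring. Qed.

Lemma dualcone_cone F X st : dualcone F X -> cone F st -> 0 <= ip X st.
Proof. by move=> [_ h] [l [s [l0 [Fs ->]]]]; rewrite ipZr mulr_ge0 // h. Qed.

(* The slack pair of a candidate [(P, st, Q)]: it vanishes exactly when
   [st = rho + P] and [g rho = st + Q]. *)
Definition slackl rho P st := rho + P - st.
Definition slackr rho g st Q := st + Q - rscale g rho.

(* The squared norm of the slack pair attains its infimum: traces of [st], [Q]
   and [P] are controlled by it. *)
Lemma slack_min F rho g s0 : free_set F -> F s0 -> psd rho ->
  exists P st Q, [/\ psd P, cone F st, psd Q &
    forall P' st' Q', psd P' -> cone F st' -> psd Q' ->
      ip (slackl rho P st) (slackl rho P st) + ip (slackr rho g st Q) (slackr rho g st Q)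
      <= ip (slackl rho P' st') (slackl rho P' st') +
         ip (slackr rho g st' Q') (slackr rho g st' Q')].
Proof.
move=> fF Fs0 pr; have [dF _] := fF.
pose K (x : 'M[C]_n * 'M[C]_n * 'M[C]_n) := [/\ psd x.1.1, cone F x.1.2 & psd x.2].
pose X (x : 'M[C]_n * 'M[C]_n * 'M[C]_n) := slackl rho x.1.1 x.1.2.
pose Y (x : 'M[C]_n * 'M[C]_n * 'M[C]_n) := slackr rho g x.1.2 x.2.
pose N x : R := ip (X x) (X x) + ip (Y x) (Y x).
have sX x : K x -> selfadj (X x).
  move=> [pP c pQ]; apply: selfadjB; last exact: psd_selfadj (cone_psd dF c).
  by apply: selfadjD; apply: psd_selfadj.
have sY x : K x -> selfadj (Y x).
  move=> [pP c pQ]; apply: selfadjB; last exact: selfadjZ (psd_selfadj pr).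
  by apply: selfadjD; [exact: psd_selfadj (cone_psd dF c)|exact: psd_selfadj].
pose E := [set N x | x in K].
have E0 : E !=set0.
  exists (N (0, 0, 0)), (0, 0, 0) => //.
  by split; [exact: psd0|exact: cone0 Fs0|exact: psd0].
have El : has_lbound E.
  by exists 0 => _ [x Kx <-]; rewrite addr_ge0 // ip_self_ge0 //; [apply: sX|apply: sY].
have hE : has_inf E by split.
pose m := inf E.
have mle x : K x -> m <= N x by move=> Kx; apply: ge_inf => //; exists x.
have /choice [x hx] k : exists x, K x /\ N x < m + harmonic k.
  have [_ [y Ky <-] h] := inf_adherent (harmonic_gt0 k) hE.
  by exists y.
have Kx k := (hx k).1.
(* The trace bound that [tr_le_ip] extracts from a squared norm of at most [m + 1]. *)
pose T := (m + 1 + ip 1%:M (1%:M : 'M[C]_n)) / 2.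
have Nb k : ip (X (x k)) (X (x k)) + ip (Y (x k)) (Y (x k)) <= m + 1.
  apply: le_trans (ltW (hx k).2) _; rewrite lerD2l /harmonic /=.
  by rewrite invf_le1 ?ler1n ?ltr0n.
have tX k : trR (X (x k)) <= T.
  have := tr_le_ip (sX _ (Kx k)); have := ip_self_ge0 (sY _ (Kx k)); have := Nb k.
  rewrite /T; move: (ip _ _) (ip _ _) (ip 1%:M _) (trR _) => *; lra.
have tY k : trR (Y (x k)) <= T.
  have := tr_le_ip (sY _ (Kx k)); have := ip_self_ge0 (sX _ (Kx k)); have := Nb k.
  rewrite /T; move: (ip _ _) (ip _ _) (ip 1%:M _) (trR _) => *; lra.
pose r := trR rho.
have tsQ k : trR (x k).1.2 + trR (x k).2 <= T + g * r.
  by have := tY k; rewrite /Y /slackr trRB trRD trRZ -/r; lra.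
have tP k : trR (x k).1.1 <= T - r + trR (x k).1.2.
  by have := tX k; rewrite /X /slackl trRB trRD -/r; lra.
have ps k : psd (x k).1.2 by have [_ c _] := Kx k; apply: cone_psd c.
have pP k : psd (x k).1.1 by have [] := Kx k.
have pQ k : psd (x k).2 by have [] := Kx k.
(* The three values of [option bool] index the three sequences, which must converge along one
   subsequence. *)
pose u (i : option bool) k :=
  match i with None => (x k).1.1 | Some true => (x k).1.2 | Some false => (x k).2 end.
have [|f hf [a ha]] := @bolzano_weierstrass_mx R (option bool) n u.
  case=> [[]|].
  - exists (T + g * r) => k; split; first exact: ps.
    by have := tsQ k; have := psd_tr_ge0 (pQ k); rewrite /u; lra.
  - exists (T + g * r) => k; split; first exact: pQ.
    by have := tsQ k; have := psd_tr_ge0 (ps k); rewrite /u; lra.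
  - exists (T - r + (T + g * r)) => k; split; first exact: pP.
    by have := tsQ k; have := psd_tr_ge0 (pQ k); have := tP k; rewrite /u; lra.
have cP := ha None; have cs := ha (Some true); have cQ := ha (Some false).
set P0 := a None in cP; set st0 := a (Some true) in cs; set Q0 := a (Some false) in cQ.
have K0 : K (P0, st0, Q0).
  split; first by apply: psd_closed cP => k; apply: pP.
    by apply: (cone_closed fF) cs => k; have [] := Kx (f k).
  by apply: psd_closed cQ => k; apply: pQ.
have cX : mx_cvg (fun k => X (x (f k))) (X (P0, st0, Q0)).
  by apply: mx_cvgB cs; apply: mx_cvgD cP; apply: mx_cvg_cst.
have cY : mx_cvg (fun k => Y (x (f k))) (Y (P0, st0, Q0)).
  by apply: mx_cvgB (mx_cvg_cst _); apply: mx_cvgD cs cQ.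
have N0 : N (P0, st0, Q0) <= m.
  rewrite -subr_ge0; apply: (@cvg_ge0 _ (fun k => m + harmonic (f k) - N (x (f k)))).
    by move=> k; rewrite subr_ge0 ltW // (hx (f k)).2.
  apply: cvgB; first exact: (cvg_subseq hf (@harmonic_cvg R m)).
  by apply: cvgD; apply: ip_cvg.
exists P0, st0, Q0; have [h1 h2 h3] := K0.
split; [exact: h1|exact: h2|exact: h3|move=> P' st' Q' pP' cst' pQ'].
by apply: le_trans N0 (mle (P', st', Q') _); split.
Qed.

(* Separation: [(A, B)] is the shortest slack pair; moving the minimiser along
   the cone of candidates, and towards its apex, gives the sign conditions. *)
Lemma infeasible_dual F rho g : free_set F -> mx_convex F -> psd rho -> rho != 0 ->
  ~ (exists st, cone F st /\ mxle rho st /\ mxle st (rscale g rho)) ->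
  exists A B, [/\ psd A, psd B, dualcone F (B - A) & g * ip B rho < ip A rho].
Proof.
move=> fF cF pr r0 infeas; have [dF _] := fF.
have [[s0 Fs0]|F0] := pselect (exists s, F s); last first.
  (* Without free states the dual cone condition is vacuous, and [B = 0] lets the pair beat every
     [g]. *)
  exists 1%:M, 0; split; [exact: psd1|exact: psd0| |].
    split; last by move=> s Fs; exfalso; apply: F0; exists s.
    by rewrite sub0r; apply: selfadjN; apply: selfadj1.
  by rewrite ip0l mulr0 ip1l psd_tr_gt0.
have [P0 [st0 [Q0 [pP0 cs0 pQ0 hmin]]]] := slack_min g fF Fs0 pr.
set A := slackl rho P0 st0 in hmin; set B := slackr rho g st0 Q0 in hmin.
have ps0 := cone_psd dF cs0.
have sA : selfadj A.
  apply: selfadjB (psd_selfadj ps0).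
  exact: selfadjD (psd_selfadj pr) (psd_selfadj pP0).
have sB : selfadj B.
  apply: selfadjB (selfadjZ _ (psd_selfadj pr)).
  exact: selfadjD (psd_selfadj ps0) (psd_selfadj pQ0).
have AB0 : 0 < ip A A + ip B B.
  rewrite lt_neqAle addr_ge0 ?ip_self_ge0 // andbT; apply/eqP => e.
  have := ip_self_ge0 sA; have := ip_self_ge0 sB => b0 a0; apply: infeas.
  have A0 : A = 0 by apply: ip_self_eq0; [|move: (ip A A) (ip B B) e a0 b0 => *; lra].
  have B0 : B = 0 by apply: ip_self_eq0; [|move: (ip A A) (ip B B) e a0 b0 => *; lra].
  exists st0; split; first exact: cs0.
  split.
    rewrite /mxle; have -> : st0 - rho = P0; last exact: pP0.
    move/eqP: A0; rewrite subr_eq0 => /eqP <-.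
    by rewrite addrAC subrr add0r.
  rewrite /mxle; have -> : rscale g rho - st0 = Q0; last exact: pQ0.
  move/eqP: B0; rewrite subr_eq0 => /eqP <-.
  by rewrite addrAC subrr add0r.
(* First-order optimality along a ray; convexity of [F] keeps the moved point among the
   candidates. *)
have dir P st Q : psd P -> cone F st -> psd Q ->
    0 <= ip A (P - st) + ip B (st + Q).
  move=> pP c pQ; pose D := P - st; pose D' := st + Q; have ps := cone_psd dF c.
  have sD : selfadj D by apply: selfadjB; apply: psd_selfadj.
  have sD' : selfadj D' by apply: selfadjD; apply: psd_selfadj.
  apply: (@quadratic_ge0 _ (ip D D + ip D' D')).
    by rewrite addr_ge0 // ip_self_ge0.
  move=> t /andP[/ltW t0 _].
  have := hmin (P0 + rscale t P) (st0 + rscale t st) (Q0 + rscale t Q)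
    (psdD pP0 (psdZ t0 pP)) (cone_add cF cs0 (cone_rscale t0 c)) (psdD pQ0 (psdZ t0 pQ)).
  have -> : slackl rho (P0 + rscale t P) (st0 + rscale t st) = A + rscale t D.
    by rewrite /A /slackl /D rscaleDr rscalerN opprD !addrA; congr (_ + _); rewrite addrAC.
  have -> : slackr rho g (st0 + rscale t st) (Q0 + rscale t Q) = B + rscale t D'.
    by rewrite /B /slackr /D' rscaleDr [in LHS]addrACA [LHS]addrAC.
  rewrite !ip_selfD -/D -/D'.
  move: (ip A A) (ip A D) (ip D D) (ip B B) (ip B D') (ip D' D') => {hmin} *; lra.
(* Shrinking the minimiser by [1 - t] also stays among the candidates, which gives the opposite sign
   in its own direction. *)
have back : ip A (P0 - st0) + ip B (st0 + Q0) <= 0.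
  pose D := P0 - st0; pose D' := st0 + Q0.
  have sD : selfadj D by apply: selfadjB; apply: psd_selfadj.
  have sD' : selfadj D' by apply: selfadjD; apply: psd_selfadj.
  rewrite -oppr_ge0; apply: (@quadratic_ge0 _ (ip D D + ip D' D')).
    by rewrite addr_ge0 // ip_self_ge0.
  move=> t /andP[_ t1]; have t1' : 0 <= 1 - t by rewrite subr_ge0.
  have := hmin _ _ _ (psdZ t1' pP0) (cone_rscale t1' cs0) (psdZ t1' pQ0).
  have -> : slackl rho (rscale (1 - t) P0) (rscale (1 - t) st0) = A + rscale (- t) D.
    rewrite /A /slackl /D !rscaleDl !rscale1 rscaleDr rscalerN opprD !addrA.
    by congr (_ + _); rewrite addrAC.
  have -> : slackr rho g (rscale (1 - t) st0) (rscale (1 - t) Q0) = B + rscale (- t) D'.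
    by rewrite /B /slackr /D' !rscaleDl !rscale1 rscaleDr [in LHS]addrACA [LHS]addrAC.
  rewrite !ip_selfD -/D -/D'.
  move: (ip A A) (ip A D) (ip D D) (ip B B) (ip B D') (ip D' D') => {hmin} *; lra.
exists A, B; split.
- apply: psd_ipP => // P pP; have := dir P 0 0 pP (cone0 Fs0) (@psd0 R n).
  by rewrite addr0 subr0 ip0r addr0.
- apply: psd_ipP => // Q pQ; have := dir 0 0 Q (@psd0 R n) (cone0 Fs0) pQ.
  by rewrite subr0 ip0r !add0r.
- split; first exact: selfadjB.
  move=> s Fs; have cs : cone F s by exists 1, s; split; [exact: ler01|split; [exact: Fs|rewrite rscale1]].
  have := dir 0 s 0 (@psd0 R n) cs (@psd0 R n).
  by rewrite sub0r addr0 ipNr ipDl ipNl addrC.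
(* The squared norm of the pair is [<A, rho> - g * <B, rho>] plus the term that [back] makes
   nonpositive, so its positivity is the strict gap. *)
- have eA : ip A A = ip A rho + ip A (P0 - st0) by rewrite -ipDr addrA.
  have eB : ip B B = ip B (st0 + Q0) - g * ip B rho by rewrite -ipZr -ipNr -ipDr.
  move: AB0 back; rewrite eA eB.
  move: (ip A rho) (ip B rho) (ip A (P0 - st0)) (ip B (st0 + Q0)) => *; lra.
Qed.

Lemma dualcone_scale F l X : 0 <= l -> dualcone F X -> dualcone F (rscale l X).
Proof.
move=> l0 [sX hX]; split; first exact: selfadjZ.
by move=> s Fs; rewrite ipZl mulr_ge0 // hX.
Qed.

Lemma Omega_dual_lower F rho g : free_set F -> mx_convex F -> psd rho -> rho != 0 ->
  (g%:E < Omega F rho)%E ->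
  exists A B, [/\ psd A, psd B, ip B rho = 1, dualcone F (B - A) & g < ip A rho].
Proof.
move=> fF cF pr r0 hg; have [dF _] := fF; have t0 := psd_tr_gt0 pr r0.
have [|A [B [pA pB dAB h]]] := @infeasible_dual F rho g fF cF pr r0.
  move=> [st [c [h1 h2]]]; move: hg; apply/negP; rewrite -leNgt.
  exact: (Omega_le_cone dF pr r0 c h1 h2).
have a0 := ip_ge0 pA pr; have b0 := ip_ge0 pB pr.
have [b_eq0|bn0] := eqVneq (ip B rho) 0; last first.
  have bp : 0 < ip B rho by rewrite lt_neqAle eq_sym bn0.
  have bi : 0 <= (ip B rho)^-1 by rewrite invr_ge0.
  exists (rscale (ip B rho)^-1 A), (rscale (ip B rho)^-1 B); split.
  - exact: psdZ.
  - exact: psdZ.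
  - by rewrite ipZl mulVf.
  - by rewrite -rscalerN -rscaleDr; apply: dualcone_scale.
  - by rewrite ipZl mulrC ltr_pdivlMr.
move: h; rewrite b_eq0 mulr0 => ap.
(* Here [<B, rho> = 0 < <A, rho>]. Scaling by [c] raises the value to [|g| + 1], and a multiple of
   the identity added to [B] restores [<B, rho> = 1]; being positive, it preserves the dual cone
   condition. *)
pose c : R := (`|g| + 1) / ip A rho.
have c0 : 0 <= c by rewrite divr_ge0 // addr_ge0.
have ti : 0 <= (trR rho)^-1 by rewrite invr_ge0 ltW.
have p1 := psdZ ti (psd1 R n).
exists (rscale c A), (rscale c B + rscale (trR rho)^-1 1%:M); split.
- exact: psdZ.
- exact: psdD (psdZ c0 pB) p1.
- by rewrite ipDl !ipZl b_eq0 mulr0 add0r ip1l mulVf ?gt_eqF.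
- have -> : rscale c B + rscale (trR rho)^-1 1%:M - rscale c A =
      rscale c (B - A) + rscale (trR rho)^-1 1%:M.
    by rewrite rscaleDr rscalerN addrAC.
  have [sX hX] := dualcone_scale c0 dAB; split.
    exact: selfadjD sX (psd_selfadj p1).
  move=> s Fs; rewrite ipDl; apply: addr_ge0; first exact: hX.
  exact: ip_ge0 p1 (dF _ Fs).1.
- rewrite ipZl /c divfK ?gt_eqF //; have := ler_norm g; lra.
Qed.

(** Every feasible [st] gives the chain [<A, rho> <= <A, st> <= <B, st> <= g * <B, rho> = g]. *)
Lemma Omega_weak_dual F rho A B : F `<=` @density R n -> psd rho -> rho != 0 ->
  psd A -> psd B -> ip B rho = 1 -> dualcone F (B - A) -> ((ip A rho)%:E <= Omega F rho)%E.
Proof.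
move=> dF pr r0 pA pB b1 dAB; apply: lee_lt_fin => g.
move=> /(Omega_lt_cone dF pr r0) [st [c [h1 h2]]]; rewrite lee_fin.
have := dualcone_cone dAB c; rewrite ipDl ipNl => h.
have := ip_mono pA h1; have := ip_mono pB h2; rewrite ipZr b1 mulr1; lra.
Qed.

Lemma Omega_dual F rho : free_set F -> mx_convex F -> psd rho -> rho != 0 ->
  Omega F rho = ereal_sup [set (ip A rho)%:E | A in [set A | exists B,
                 psd A /\ psd B /\ ip B rho = 1 /\ dualcone F (B - A)]].
Proof.
move=> fF cF pr r0; apply/eqP; rewrite eq_le; apply/andP; split.
  apply: lee_gt_fin => g /(Omega_dual_lower fF cF pr r0) [A [B [pA pB b1 d h]]].
  apply: (@le_trans _ _ (ip A rho)%:E); first by rewrite lee_fin ltW.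
  by apply: ereal_sup_ubound; exists A => //; exists B.
apply/ereal_supP => _ [A [B [pA [pB [b1 d]]]] <-].
exact: (Omega_weak_dual fF.1 pr r0 pA pB b1 d).
Qed.

Lemma Omega_dual_ratio F rho : free_set F -> mx_convex F -> psd rho -> rho != 0 ->
  Omega F rho = ereal_sup [set ((ip AB.1 rho) / (ip AB.2 rho))%:E | AB in
                 [set AB : 'M[C]_n * 'M[C]_n | psd AB.1 /\ psd AB.2 /\
                    ip AB.2 rho != 0 /\
                    (forall s, F s -> ip AB.2 s != 0 /\ ip AB.1 s / ip AB.2 s <= 1)]].
Proof.
move=> fF cF pr r0; have [dF _] := fF; have t0 := psd_tr_gt0 pr r0.
apply/eqP; rewrite eq_le; apply/andP; split; last first.
  apply/ereal_supP => _ [[A B] /= [pA [pB [bn0 hAB]]] <-].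
  have bp : 0 < ip B rho by rewrite lt_neqAle eq_sym bn0 ip_ge0.
  have bi : 0 <= (ip B rho)^-1 by rewrite invr_ge0 ltW.
  rewrite mulrC -ipZl; apply: (Omega_weak_dual dF pr r0 (psdZ bi pA) (psdZ bi pB)).
    by rewrite ipZl mulVf.
  rewrite -rscalerN -rscaleDr; apply: dualcone_scale => //; split.
    by apply: selfadjB; apply: psd_selfadj.
  move=> s Fs; have [bs hs] := hAB _ Fs; have [ps _] := dF _ Fs.
  have bsp : 0 < ip B s by rewrite lt_neqAle eq_sym bs ip_ge0.
  by move: hs; rewrite ler_pdivrMr // mul1r ipDl ipNl subr_ge0.
apply: lee_gt_fin => g /(Omega_dual_lower fF cF pr r0) [A [B [pA pB b1 [_ d] h]]].
have a0 := ip_ge0 pA pr.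
(* [B] may vanish on a free state, so it is shifted by [e] times the identity. The strict gap pays
   for the shift: for [g > 0] the chosen [e] makes the ratio exactly [g]. *)
have [e e0 he] : exists2 e, 0 < e & g <= ip A rho / (1 + e * trR rho).
  have [g0|g0] := leP g 0.
    exists 1 => //; apply: le_trans g0 _; rewrite divr_ge0 //; lra.
  exists ((ip A rho - g) / (g * trR rho)); first by rewrite divr_gt0 ?mulr_gt0 // subr_gt0.
  have -> : 1 + (ip A rho - g) / (g * trR rho) * trR rho = ip A rho / g.
    by field; rewrite !gt_eqF.
  by rewrite invf_div mulrCA divff ?mulr1 // gt_eqF // (lt_trans g0 h).
have p1 := psdZ (ltW e0) (psd1 R n).
apply: (@le_trans _ _ (ip A rho / ip (B + rscale e 1%:M) rho)%:E).
  by rewrite lee_fin ipDl ipZl ip1l b1.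
apply: ereal_sup_ubound; exists (A, B + rscale e 1%:M); last by [].
split; first exact: pA.
split; first exact: psdD pB p1.
rewrite /=.
split; first by rewrite ipDl ipZl ip1l b1 gt_eqF // ltr_wpDr // mulr_ge0 // ltW.
move=> s Fs; have /densityE[ps ts] := dF _ Fs.
have bs := ip_ge0 pB ps; have := d s Fs; rewrite ipDl ipNl => hs.
rewrite ipDl ipZl ip1l ts mulr1; have bp : 0 < ip B s + e by lra.
by split; [rewrite gt_eqF|rewrite ler_pdivrMr // mul1r; lra].
Qed.

(** The spectral values [d i] are eigenvalues, so none lies below the infimum [m], and [rho - m 1]
    is a congruence of a nonnegative diagonal. *)
Lemma lambda_minP rho : density rho ->
  exists m, [/\ 0 <= m, lambda_min rho = m%:E & mxle (rscale m 1%:M) rho].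
Proof.
move=> dr; have [pr _] := dr; have [P [d [P1 P2 d0 er]]] := psd_spectral pr.
have n0 : (0 < n)%N.
  case: (posnP n) => // n0; have /negP[] := density_neq0 dr.
  apply/eqP/matrixP => i j; exfalso; have := ltn_ord i.
  by rewrite [X in (_ < X)%N]n0.
have lb : (0 <= lambda_min rho)%E.
  apply/ereal_infP => _ [l /= /eigenvalueP[v ev vn0] <-]; rewrite lee_fin.
  have := pr.2 (adjmx v); rewrite adjmxK ev -scalemxAl mxE => h.
  have vv : 0 < (v *m adjmx v) 0 0.
    rewrite lt_neqAle; apply/andP; split; last first.
      rewrite mxE; apply: sumr_ge0 => i _; rewrite adjmxE; exact: mul_conjC_ge0.
    apply: contra vn0; rewrite eq_sym mxE psumr_eq0; last first.
      by move=> i _; rewrite adjmxE mul_conjC_ge0.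
    move=> /allP hv; apply/eqP/rowP => i; have := hv i (mem_index_enum _).
    by rewrite adjmxE mul_conjC_eq0 mxE => /eqP.
  by move: h; rewrite pmulr_lge0 // ler0c.
have ub i : (lambda_min rho <= (d i)%:E)%E.
  apply: ereal_inf_lbound; exists (d i) => //=; apply/eigenvalueP.
  (* [eigenvalue] refers to row vectors, and the rows of [P] are the eigenvectors. *)
  exists (row i P); last first.
    apply/negP => /eqP e; have /rowP /(_ i) : row i (P *m adjmx P) = 0 by rewrite row_mul e mul0mx.
    by rewrite P2 !mxE eqxx => /eqP; rewrite oner_eq0.
  rewrite er !mulmxA -row_mul P2 -row_mul mul1mx -row_mul.
  by rewrite mul_diag_mx; apply/rowP => j; rewrite !mxE.
have fin : lambda_min rho \is a fin_num.
  rewrite ge0_fin_numE //; apply: le_lt_trans (ub (Ordinal n0)) (ltry _).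
exists (fine (lambda_min rho)); rewrite fineK //; split => //; first exact: fine_ge0.
set m := fine _; have dm i : 0 <= d i - m.
  by rewrite subr_ge0 -lee_fin /m fineK.
rewrite /mxle; have := psd_congr P (psd_diag dm).
have -> : diag_mx (\row_i (d i - m)%:C%C) =
    diag_mx (\row_i (d i)%:C%C) - rscale m 1%:M.
  by apply/matrixP => i j; rewrite !mxE rmorphB mulrnBl mulr_natr.
rewrite mulmxBr mulmxBl -er /rscale -scalemxAr -scalemxAl mulmx1.
by rewrite P1.
Qed.

End Dim.
End Duality.

(** * Bounds by robustness, weight and smallest eigenvalue *)

Section Bounds.
Variables (R : realType) (n : nat).
Local Notation C := R[i].
Implicit Types (rho s : 'M[C]_n) (F : set 'M[C]_n).

(** For [m > 0] one has [s <= 1 <= m^-1 rho]; for [m = 0] the inverse is [+oo] by convention. *)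
Lemma Rmax_le_lambda_min s rho : density s -> density rho ->
  (Rmax s rho <= (lambda_min rho)^-1)%E.
Proof.
move=> ds dr; have [m [m0 -> hm]] := lambda_minP dr; rewrite inver.
have [_|mn0] := eqVneq m 0; first exact: leey.
have mp : 0 < m by rewrite lt_neqAle eq_sym mn0.
have mi : 0 <= m^-1 by rewrite invr_ge0.
apply: (Rmax_le mi (mxle_trans (density_le1 ds) _)).
by have := mxleZ mi hm; rewrite (rscaleK _ mp).
Qed.

Lemma robustness_ge1 F rho : F `<=` @density R n -> density rho ->
  (1 <= robustness F rho)%E.
Proof. by move=> dF dr; apply/ereal_infP => _ [s Fs <-]; apply: Rmax_ge1 dr (dF _ Fs). Qed.

Lemma weightV F rho : ((weight F rho)^-1)%E = ereal_inf [set Rmax s rho | s in F].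
Proof. by rewrite /weight inveK. Qed.

Lemma robustness_weight_le F rho :
  (robustness F rho * (weight F rho)^-1 <= Omega F rho)%E.
Proof.
rewrite weightV; apply/ereal_infP => _ [s Fs <-]; apply: lee_pmul.
- by apply/ereal_infP => _ [t _ <-]; apply: Rmax_ge0.
- by apply/ereal_infP => _ [t _ <-]; apply: Rmax_ge0.
- by apply: ereal_inf_lbound; exists s.
- by apply: ereal_inf_lbound; exists s.
Qed.

Lemma Omega_le_Rmax F rho s : F s -> (Omega F rho <= Rmax rho s * Rmax s rho)%E.
Proof. by move=> Fs; apply: ereal_inf_lbound; exists s. Qed.

(** No optimal free state is assumed: the bound holds for each [s] and passes to the infimum, as its
    second factor does not depend on [s]. *)
Lemma Omega_le_lambda_min F rho : F `<=` @density R n -> density rho ->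
  (Omega F rho <= robustness F rho * (lambda_min rho)^-1)%E.
Proof.
move=> dF dr; have [m [m0 em _]] := lambda_minP dr.
have key s : F s -> (Omega F rho <= Rmax rho s * (lambda_min rho)^-1)%E.
  move=> Fs; apply: le_trans (Omega_le_Rmax _ Fs) _.
  by apply: lee_wpmul2l; [exact: Rmax_ge0|apply: Rmax_le_lambda_min => //; apply: dF].
have r1 := robustness_ge1 dF dr.
move: key; rewrite em inver; have [_ _|mn0 key] := eqVneq m 0.
  (* The robustness is at least one, so its product with the infinite factor is [+oo]. *)
  by rewrite gt0_muley ?leey // (lt_le_trans _ r1) // lte01.
have mp : 0 < m by rewrite lt_neqAle eq_sym mn0.
rewrite lee_pdivlMr //; apply/ereal_infP => _ [s Fs <-].
by rewrite -lee_pdivlMr //; apply: key.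
Qed.

End Bounds.

(** * Tensor products and powers *)

Section Tensor.
Variable R : realType.
Local Notation C := R[i].
Local Notation trR A := (complex.Re (\tr A)).

Lemma mule_ge1_fin (a b : \bar R) : (1 <= a)%E -> (1 <= b)%E ->
  (a * b = +oo)%E \/ (a < +oo)%E /\ (b < +oo)%E.
Proof.
move=> /(lt_le_trans lte01) a0 /(lt_le_trans lte01) b0.
have [|h] := leP +oo%E (a * b)%E; first by rewrite leye_eq => /eqP; left.
by right; apply: mule_lty h.
Qed.

Lemma adjmx_tens m n p q (A : 'M[C]_(m, n)) (B : 'M[C]_(p, q)) :
  adjmx (tensmx A B) = tensmx (adjmx A) (adjmx B).
Proof. by rewrite /adjmx trmx_tens map_mxT. Qed.

Lemma psd_tens m n (A : 'M[C]_m) (B : 'M[C]_n) : psd A -> psd B -> psd (tensmx A B).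
Proof.
move=> /psd_gramP[X ->] /psd_gramP[Y ->]; rewrite -tensmx_mul -adjmx_tens.
exact: psd_gram.
Qed.

Lemma tensmx_rscale m n (a b : R) (A : 'M[C]_m) (B : 'M[C]_n) :
  tensmx (rscale a A) (rscale b B) = rscale (a * b) (tensmx A B).
Proof. by apply/matrixP => i j; rewrite !mxE rmorphM mulrACA. Qed.

Lemma mxle_tens m n (A B : 'M[C]_m) (D E : 'M[C]_n) : psd A -> psd E ->
  mxle A B -> mxle D E -> mxle (tensmx A D) (tensmx B E).
Proof.
move=> pA pE AB DE; rewrite /mxle.
(* Changing one tensor factor at a time leaves two tensor products of positive operators. *)
have -> : tensmx B E - tensmx A D = tensmx (B - A) E + tensmx A (E - D).
  apply/matrixP => i j; rewrite !mxE; ring.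
by apply: psdD; apply: psd_tens.
Qed.

Lemma psd_ntens d (A : 'M[C]_d) k : psd A -> psd (ntensmx A k.+1).
Proof. by move=> pA; elim: k => [|k ih] //; rewrite ntensmxSS; apply: psd_tens. Qed.

Lemma ntensmx_rscale d (a : R) (A : 'M[C]_d) k :
  ntensmx (rscale a A) k.+1 = rscale (a ^+ k.+1) (ntensmx A k.+1).
Proof.
elim: k => [|k ih]; first by rewrite expr1.
by rewrite !ntensmxSS ih tensmx_rscale -exprS.
Qed.

Lemma mxle_ntens d (A B : 'M[C]_d) k : psd A -> psd B -> mxle A B ->
  mxle (ntensmx A k.+1) (ntensmx B k.+1).
Proof.
move=> pA pB AB; elim: k => [|k ih]; first exact: AB.
by rewrite !ntensmxSS; apply: mxle_tens => //; apply: psd_ntens.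
Qed.

(** For a state the trace comparison gives [1 <= l], so the optimiser is a positive multiple of a
    free state, to which the tensor hypotheses apply. *)
Lemma Omega_attained_state n (F : set 'M[C]_n) rho : free_set F -> density rho ->
  (Omega F rho < +oo)%E -> exists g l s,
  [/\ 0 <= g, 0 < l & F s] /\
  [/\ mxle rho (rscale l s), mxle (rscale l s) (rscale g rho) & Omega F rho = g%:E].
Proof.
move=> fF dr h; have [dF _] := fF; have [pr _] := dr.
have [g [st [[l [s [l0 [Fs est]]]] [h1 [h2 eg]]]]] :=
  Omega_attained fF pr (density_neq0 dr) h.
have /densityE[_ tr] := dr; have /densityE[_ ts] := dF _ Fs.
exists g, l, s; rewrite est in h1 h2; split; last by split.
split; [by rewrite -lee_fin -eg Omega_ge0| |exact: Fs].
by have := mxle_tr h1; rewrite trRZ tr ts mulr1 => /(lt_le_trans ltr01).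
Qed.

Lemma Omega_tens d1 d2 (F1 : set 'M[C]_d1) (F2 : set 'M[C]_d2)
    (F12 : set 'M[C]_(d1 * d2)) rho w :
  free_set F1 -> free_set F2 -> (forall s1 s2, F1 s1 -> F2 s2 -> F12 (tensmx s1 s2)) ->
  density rho -> density w ->
  (Omega F12 (tensmx rho w) <= Omega F1 rho * Omega F2 w)%E.
Proof.
move=> f1 f2 hF dr dw.
(* Both values are at least one, so the product is [+oo] as soon as one of them is; otherwise the
   optimal points can be tensored. *)
have [->|[y1 y2]] := mule_ge1_fin (Omega_ge1 f1.1 dr) (Omega_ge1 f2.1 dw).
  exact: leey.
have [g1 [l1 [s1 [[g10 l10 Fs1] [h1 k1 ->]]]]] := Omega_attained_state f1 dr y1.
have [g2 [l2 [s2 [[g20 l20 Fs2] [h2 k2 ->]]]]] := Omega_attained_state f2 dw y2.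
have [pr _] := dr; have [pw _] := dw.
have ps1 := psdZ (ltW l10) (f1.1 _ Fs1).1; have ps2 := psdZ (ltW l20) (f2.1 _ Fs2).1.
rewrite -EFinM.
apply: (Omega_le (hF _ _ Fs1 Fs2) (mulr_gt0 l10 l20) (mulr_ge0 g10 g20)).
  by rewrite -tensmx_rscale; apply: mxle_tens pr ps2 h1 h2.
by rewrite -!tensmx_rscale; apply: mxle_tens ps1 (psdZ g20 pw) k1 k2.
Qed.

Lemma expeyS k : (+oo ^+ k.+1 = +oo :> \bar R)%E.
Proof. by elim: k => [|k ih]; rewrite ?expe1 // expeS ih mulyy. Qed.

Lemma Omega_ntens d (F : set 'M[C]_d) k (Fk : set 'M[C]_(d ^ k.+1)) rho :
  free_set F -> (forall s, F s -> Fk (ntensmx s k.+1)) -> density rho ->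
  (Omega Fk (ntensmx rho k.+1) <= (Omega F rho) ^+ k.+1)%E.
Proof.
move=> fF hF dr; have [pr _] := dr.
have [|y] := leP +oo%E (Omega F rho).
  by rewrite leye_eq => /eqP ->; rewrite expeyS leey.
have [g [l [s [[g0 l0 Fs] [h1 h2 ->]]]]] := Omega_attained_state fF dr y.
have ps := psdZ (ltW l0) (fF.1 _ Fs).1; rewrite -EFin_expe.
apply: (Omega_le (hF _ Fs) (exprn_gt0 k.+1 l0) (exprn_ge0 k.+1 g0)).
  by rewrite -ntensmx_rscale; apply: mxle_ntens pr ps h1.
by rewrite -!ntensmx_rscale; apply: mxle_ntens ps (psdZ g0 pr) h2.
Qed.

End Tensor.

Theorem theorem1 (R : realType) :
  (forall (n : nat) (F : set 'M[R[i]]_n), free_set F ->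
    (* (i) finiteness <-> a free state with the same support *)
    (forall rho, density rho ->
       ((Omega F rho < +oo)%E <-> exists s, F s /\ same_support s rho))
    (* (ii) scale invariance *)
    /\ (forall rho (l : R), psd rho -> 0 < l -> Omega F (rscale l rho) = Omega F rho)
    (* (iii) conic formulation, attainment, and duality for convex F *)
    /\ (forall rho, psd rho -> rho != 0 ->
         Omega F rho = ereal_inf [set g%:E | g in [set g : R | exists st,
              cone F st /\ mxle rho st /\ mxle st (rscale g rho)]]
         /\ ((Omega F rho < +oo)%E -> exists (g : R) st,
              cone F st /\ mxle rho st /\ mxle st (rscale g rho) /\ Omega F rho = g%:E)
         /\ (mx_convex F ->
              Omega F rho = ereal_sup [set (ip A rho)%:E | A in [set A | exists B,
                 psd A /\ psd B /\ ip B rho = 1 /\ dualcone F (B - A)]]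
           /\ Omega F rho = ereal_sup [set ((ip AB.1 rho) / (ip AB.2 rho))%:E | AB in
                 [set AB : 'M[R[i]]_n * 'M[R[i]]_n | psd AB.1 /\ psd AB.2 /\
                    ip AB.2 rho != 0 /\
                    (forall s, F s -> ip AB.2 s != 0 /\ ip AB.1 s / ip AB.2 s <= 1)]]))
    (* (iv) faithfulness *)
    /\ (forall rho, density rho -> (Omega F rho = 1%E <-> F rho))
    (* (vi) quasi-convexity *)
    /\ (mx_convex F -> forall rho w (t : R), density rho -> density w -> 0 <= t <= 1 ->
          (Omega F (rscale t rho + rscale (1 - t) w)
             <= Order.max (Omega F rho) (Omega F w))%E)
    (* (vii) lower semicontinuity *)
    /\ (forall (u : nat -> 'M[R[i]]_n) rho, (forall k, density (u k)) -> mx_cvg u rho ->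
          (Omega F rho <= limn_einf (fun k => Omega F (u k)))%E)
    (* (viii) bounds via robustness and weight *)
    /\ (forall rho, density rho ->
          (robustness F rho * (weight F rho)^-1 <= Omega F rho)%E
          /\ (Omega F rho <= robustness F rho * (lambda_min rho)^-1)%E
          /\ (forall sR, F sR -> robustness F rho = Rmax rho sR ->
                (Omega F rho <= robustness F rho * Rmax sR rho)%E
                /\ (robustness F rho * Rmax sR rho
                      <= robustness F rho * (lambda_min rho)^-1)%E)
          /\ (forall sW, F sW -> weight F rho = ((Rmax sW rho)^-1)%E ->
                (Omega F rho <= (weight F rho)^-1 * Rmax rho sW)%E)))
  (* (v) submultiplicativity under tensor products *)
  /\ (forall (d1 d2 : nat) (F1 : set 'M[R[i]]_d1) (F2 : set 'M[R[i]]_d2)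
        (F12 : set 'M[R[i]]_(d1 * d2)),
        free_set F1 -> free_set F2 -> free_set F12 ->
        (forall s1 s2, F1 s1 -> F2 s2 -> F12 (tensmx s1 s2)) ->
        forall rho w, density rho -> density w ->
          (Omega F12 (tensmx rho w) <= Omega F1 rho * Omega F2 w)%E)
  /\ (forall (d : nat) (F0 : set 'M[R[i]]_d) (Fk : forall k : nat, set 'M[R[i]]_(d ^ k)),
        free_set F0 -> (forall k, free_set (Fk k)) ->
        (forall s k, F0 s -> Fk k (ntensmx s k)) ->
        forall rho (k : nat), density rho -> (0 < k)%N ->
          (Omega (Fk k) (ntensmx rho k) <= (Omega F0 rho) ^+ k)%E).
Proof.
split; last split.
- move=> n F fF; have [dF cF] := fF.
  split; first by move=> rho; apply: Omega_fin.
  split; first by move=> rho l _; apply: Omega_scale.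
  split.
    move=> rho pr r0; split; first exact: Omega_conic.
    split; first exact: Omega_attained.
    move=> cvF; split; first exact: Omega_dual.
    exact: Omega_dual_ratio.
  split; first by move=> rho; apply: Omega_eq1.
  split; first by move=> cvF rho w t; apply: Omega_quasiconvex.
  split; first by move=> u rho; apply: Omega_lsc.
  move=> rho dr; split; first exact: robustness_weight_le.
  split; first exact: Omega_le_lambda_min.
  split.
    move=> sR FsR ->; split; first exact: Omega_le_Rmax.
    apply: lee_wpmul2l; first exact: Rmax_ge0.
    exact: Rmax_le_lambda_min (dF _ FsR) dr.
  move=> sW FsW ->; rewrite inveK muleC; exact: Omega_le_Rmax.
- move=> d1 d2 F1 F2 F12 f1 f2 _ hF rho w dr dw; exact: (Omega_tens f1 f2 hF dr dw).
- move=> d F0 Fk f0 _ hF rho [//|k] dr _.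
  exact: (Omega_ntens f0 (fun s => hF s k.+1) dr).
Qed.
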